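(* For every integer $n\ge 3$ the $(n+6)$-point quadrature formula $$Q_{n+6}[f]=\frac{13}{72n}\sigma(0)+\frac{1}{2n}\sigma\Big(\frac1{2n}\Big)+\frac{4}{9n}\sigma\Big(\frac3{4n}\Big)-\frac{1}{8n}\sigma\Big(\frac1n\Big)+\frac1n\sum_{k=2}^{n-1}f\Big(\frac{2k-1}{2n}\Big),\qquad \sigma(x):=f(x)+f(1-x),$$ is negative definite of order $4$, with error constant $$c_4(Q_{n+6})=-\frac{7}{5760\,n^4}\Big(1-\frac{15}{14\,n}\Big),$$ and the sequence $\{Q_{n+6}\}$ is asymptotically optimal negative definite of order $4$, i.e. $\lim_{n\to\infty}c_4(Q_{n+6})/c^{-}_{n+6,4}=1$.
   Context: An $N$-point quadrature formula is a functional $Q[f]=\sum_{i=1}^{N}a_i f(\tau_i)$ with nodes $0\le\tau_1<\dots<\tau_N\le 1$ and real weights; its remainder is $R[Q;f]=\int_0^1 f(x)\,dx-Q[f]$. $Q$ is negative definite of order $4$, with error constant $c_4(Q)$, if there is a constant $c_4(Q)<0$ such that for every $f\in C^4[0,1]$ there is $\xi\in[0,1]$ with $R[Q;f]=c_4(Q)f^{(4)}(\xi)$. $c^{-}_{N,4}$ denotes the supremum (largest negative value) of $c_4(Q)$ over all $N$-point negative definite quadrature formulae $Q$ of order $4$. *)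

(* Defs.v *)
From Stdlib Require Import Reals.
From Coquelicot Require Import Coquelicot.
Open Scope R_scope.

Definition I01 (x : R) : Prop := 0 <= x <= 1.

(* [g] is the [r]-th derivative of [f] on [0,1]. [D_in] takes its limit within
   [I01], so derivatives at 0 and 1 are one-sided and the values of [f] and [g]
   outside [0,1] play no role. *)
Fixpoint nth_deriv_on (r : nat) (f g : R -> R) : Prop :=
  match r with
  | O => forall x, I01 x -> f x = g x
  | S r' => exists h : R -> R,
      (forall x, I01 x -> D_in f h I01 x) /\ nth_deriv_on r' h g
  end.

(* f is in C^r[0,1], with f^(r) = g on [0,1]. *)
Definition C_on (r : nat) (f g : R -> R) : Prop :=
  nth_deriv_on r f g /\ forall x, I01 x -> continue_in g I01 x.

Definition is_quadrature (N : nat) (Q : (R -> R) -> R) : Prop :=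
  exists tau a : nat -> R,
    (forall i, (1 <= i <= N)%nat -> 0 <= tau i <= 1) /\
    (forall i j, (1 <= i)%nat -> (i < j)%nat -> (j <= N)%nat -> tau i < tau j) /\
    (forall f : R -> R, Q f = sum_n_m (fun i => a i * f (tau i)) 1 N).

Definition remainder (Q : (R -> R) -> R) (f : R -> R) : R := RInt f 0 1 - Q f.

Definition has_error_constant (r : nat) (Q : (R -> R) -> R) (c : R) : Prop :=
  forall f g : R -> R, C_on r f g ->
    exists xi : R, 0 <= xi <= 1 /\ remainder Q f = c * g xi.

Definition negative_definite (r : nat) (Q : (R -> R) -> R) : Prop :=
  exists c : R, c < 0 /\ has_error_constant r Q c.

(* The constant is unique when it exists (test on x^r / r!); meaningless
   otherwise. *)
Definition error_constant (r : nat) (Q : (R -> R) -> R) : R :=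
  iota (has_error_constant r Q).

(* The supremum c^-_{N,r}; the set is bounded above by 0, so [Lub_Rbar] is finite
   as soon as one N-point negative definite formula of order r exists. *)
Definition c_minus (N r : nat) : R :=
  real (Lub_Rbar (fun c : R => exists Q : (R -> R) -> R,
    is_quadrature N Q /\ negative_definite r Q /\ c = error_constant r Q)).

Definition sigma (f : R -> R) (x : R) : R := f x + f (1 - x).

(* The (n+6)-point formula Q_{n+6}, for n >= 3. *)
Definition Qform (n : nat) (f : R -> R) : R :=
  13 / (72 * INR n) * sigma f 0
  + 1 / (2 * INR n) * sigma f (1 / (2 * INR n))
  + 4 / (9 * INR n) * sigma f (3 / (4 * INR n))
  - 1 / (8 * INR n) * sigma f (1 / INR n)
  + 1 / INR n *
      sum_n_m (fun k => f ((2 * INR k - 1) / (2 * INR n))) 2 (n - 1).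

(* Main.v *)
Require Import Defs.
From Stdlib Require Import Reals Lra Lia Psatz Classical Compare_dec FunctionalExtensionality.
From Coquelicot Require Import Coquelicot.
Open Scope R_scope.

(** The formula is negative definite because its Peano kernel, an explicit
    piecewise quartic, is nonpositive; integrating by parts against the kernel
    over each gap gives R[f] <= 0 whenever f'''' >= 0, and the mean value form
    follows from R[x^4/24] = c and the intermediate value theorem.

    For optimality, let Q be any N-point negative definite formula with constant c.
    If f vanishes at all nodes and f'''' = 1 minus a positive combination of point
    masses, then c <= R[f], which is the integral of f.  On a gap of length h,
    let f be the "arch" having double zeros at both ends, second derivatives -A/12
    and -B/12 there, and one interior point mass; this determines it.  The arches
    glue to an admissible f as soon as the third derivative jumps downwards at each
    node, a condition increasing in the value A at that node and decreasing in
    its neighbours.  Hence there is a largest sequence of values A, bounded by a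
    cap, satisfying all the conditions, and at each node either the cap is
    attained or the third derivative does not jump.  With Lagrange multipliers that
    vanish at the cap, an inequality for a single gap sums up to the statement
    that equal gaps are the worst case: the integral of f is at most
    -7/(5760 M^4) for M <= N + 1 gaps. *)

(** * The inequality for one gap *)

(* [slope A B h / 12] is the outgoing third derivative, at the end with value [A],
   of the arch on a gap of length [h]; [- gain A B h / 5760] is its integral. *)
Definition slope (A B h : R) : R :=
  ((h ^ 2 + A) ^ 2 / (h ^ 2 + B) + 3 * A - 3 * h ^ 2) / h.

Definition gain (A B h : R) : R :=
  20 * h ^ 3 * ((h ^ 2 + A) * (h ^ 2 + B)) / (2 * h ^ 2 + A + B) - 8 * h ^ 5.

Definition clamp (k t : R) : R := Rmax (- k) (Rmin k t).

(** Both terms besides [20 a^2] are nonnegative: the coefficient of [a] factors as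
    [10 (h^2 - 2)(h^2 + 1)], and [2 h^5] lies above a tangent. The surplus [20 a^2] absorbs unequal
    end values in [unclamped_nonneg]. *)
Lemma gap_poly_ge_square (h a : R) : 0 < h -> 2 <= h ^ 2 -> 0 <= a ->
  20 * a ^ 2 <= 20 * a ^ 2 + a * (10 * h ^ 4 - 10 * h ^ 2 - 20)
       + 2 * h ^ 6 - 25 * h ^ 2 + 28 * h.
Proof.
intros Hh H2 Ha.
assert (0 <= a * (10 * h ^ 4 - 10 * h ^ 2 - 20)).
{ apply Rmult_le_pos; [lra|].
  replace (10 * h ^ 4 - 10 * h ^ 2 - 20) with (10 * ((h^2-2)*(h^2+1))) by ring.
  assert (0 <= (h^2-2)*(h^2+1)) by (apply Rmult_le_pos; lra). lra. }
assert (0 <= h * (2*h^5 - 25*h+28)).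
{ apply Rmult_le_pos; [lra|].
  (* This product is [h^5] minus its tangent at [63/50], close to where [2 h^5 - 25 h] is least. *)
  assert (0 <= (h - 63/50)^2 * (h^3+2*(63/50)*h^2+3*(63/50)^2*h+4*(63/50)^3)).
  { apply Rmult_le_pos; [apply pow2_ge_0|].
    assert (0 <= h^3) by (apply pow_le; lra). nra. }
  nra. }
lra.
Qed.

(** The polynomial is [h] times the right side minus the left side of the unclamped gap inequality
    at [A = B = a]. For [h^2 < 2], its minimum in [a], at [4 a = 2 + h^2 - h^4], has the factor
    [(h - 1)^2]: equality is reached at [h = 1], [a = 1/2]. *)
Lemma gap_poly_nonneg (h a : R) : 9 / 20 <= h -> 0 <= a ->
  0 <= 20 * a ^ 2 + a * (10 * h ^ 4 - 10 * h ^ 2 - 20)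
       + 2 * h ^ 6 - 25 * h ^ 2 + 28 * h.
Proof.
intros Hh Ha.
destruct (Rle_dec 2 (h ^ 2)) as [H2|H2].
- pose proof (gap_poly_ge_square h a ltac:(lra) H2 Ha). pose proof (pow2_ge_0 a). lra.
- assert (S : 0 <= -5*h^6-10*h^5+3*h^4+16*h^3+44*h^2+72*h-20).
  { assert (0 <= h^4 * (2 - h^2)) by (apply Rmult_le_pos; [apply pow_le|]; lra).
    assert (0 <= h^3 * (2 - h^2)) by (apply Rmult_le_pos; [apply pow_le|]; lra).
    assert (0 <= h^2 * (2 - h^2)) by (apply Rmult_le_pos; [apply pow_le|]; lra).
    assert (0 <= h * (2 - h^2)) by (apply Rmult_le_pos; lra).
    assert (0 <= h^4) by (apply pow_le; lra).
    nra. }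
  assert (0 <= (h-1)^2 * (-5*h^6-10*h^5+3*h^4+16*h^3+44*h^2+72*h-20))
    by (apply Rmult_le_pos; [apply pow2_ge_0|lra]).
  assert (0 <= (20 * a - 5*(2+h^2-h^4))^2) by apply pow2_ge_0.
  nra.
Qed.

(** The left side is [h^2] times a bound for the loss due to unequal end values. The cubic term in
    [a] is bounded below by a quadratic touching it at [a = 31/100]; what is left is a discriminant
    condition on [h] alone. *)
Lemma gap_poly_ge_cubic (h a : R) : 9 / 20 <= h -> 0 <= a -> 2 * a <= 1 - h ^ 2 ->
  20 * a ^ 2 * (1 - 2 * a - h ^ 2) <=
  h ^ 2 * (20 * a ^ 2 + a * (10 * h ^ 4 - 10 * h ^ 2 - 20)
       + 2 * h ^ 6 - 25 * h ^ 2 + 28 * h).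
Proof.
intros Hh Ha Hb.
assert (H1 : h <= 1).
{ apply Rnot_lt_le; intros H.
  assert (1 * 1 < h * h) by (apply Rmult_le_0_lt_compat; lra). nra. }
assert (Hcub : 40 * (62/100) * a^2 - 40 * (961/10000) * a <= 40 * a^3).
{ assert (0 <= a * (a - 31/100)^2) by (apply Rmult_le_pos; [lra|apply pow2_ge_0]). nra. }
set (u := h ^ 2) in *.
assert (Hu : 81/400 <= u <= 1) by (unfold u; nra).
assert (Hlin : 20 * u + 10 * u^2 - 10 * u^3 <= 24 * u - 444/1000).
{ assert (0 <= (u - 1/5) * (10*u^2 - 8*u + 24/10)) by (apply Rmult_le_pos; nra). nra. }
(* The discriminant condition. In powers of [s = h - 9/20], each at most [11/20] times the previous
   one, it becomes a linear problem. *)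
assert (Hp : (17/10 + 12 * u)^2 <= (40 * u + 24/5) * (2 * u^4 - 25 * u^2 + 28 * h^3)).
{ unfold u. replace h with (9/20 + (h - 9/20)) by ring.
  set (s := h - 9/20). assert (Hs : 0 <= s <= 11/20) by (unfold s; lra).
  clearbody s. clear - Hs.
  assert (0 <= s*(11/20-s)) by nra.
  assert (P : forall k, 0 <= s^k) by (intros k; apply pow_le; lra).
  assert (Q : forall k, s^(S k) <= 11/20 * s^k).
  { intros k. simpl. specialize (P k). nra. }
  pose proof (Q 1%nat). pose proof (Q 2%nat). pose proof (Q 3%nat).
  pose proof (Q 4%nat). pose proof (Q 5%nat).
  pose proof (P 5%nat). pose proof (P 6%nat).
  pose proof (P 7%nat). pose proof (P 8%nat). pose proof (P 9%nat). pose proof (P 10%nat).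
  ring_simplify. simpl (Init.Nat.add _ _) in *. lra. }
assert (Hsq : 0 <= ((40*u+24/5) * a - (17/10 + 12 * u))^2) by apply pow2_ge_0.
assert (0 <= (40*u+24/5) * a^2 - (34/10+24*u) * a + (2 * u^4 - 25 * u^2 + 28 * h^3)).
{ apply Rmult_le_reg_l with (40*u+24/5); [lra|]. nra. }
assert (a * (20 * u + 10 * u^2 - 10 * u^3) <= a * (24 * u - 444/1000)) by nra.
replace (u * (20 * a ^ 2 + a * (10 * h ^ 4 - 10 * u - 20) + 2 * h ^ 6 - 25 * u + 28 * h))
 with (20*u*a^2 - a * (20 * u + 10 * u^2 - 10 * u^3) + 2 * u^4 - 25 * u^2 + 28*h^3)
 by (unfold u; ring).
nra.
Qed.

Lemma unclamped_nonneg (A B h : R) : 9 / 20 <= h <= 9 / 5 -> 0 <= A <= 1 -> 0 <= B <= 1 ->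
  35 * h - 28 + 5 / 2 * (1 - A) * slope A B h + 5 / 2 * (1 - B) * slope B A h
    <= gain A B h.
Proof.
intros Hh HA HB.
(* In the mean [a] and half-difference [d], the difference of the sides is a perturbation, linear
   in [d ^ 2] up to the denominator, of the symmetric case [A = B = a]. *)
set (a := (A + B) / 2). set (d := (A - B) / 2). set (e := d ^ 2). set (W := h ^ 2 + a).
assert (Hh2 : 0 < h ^ 2) by (apply pow_lt; lra).
assert (Ha : 0 <= a <= 1) by (unfold a; lra).
assert (He0 : 0 <= e) by apply pow2_ge_0.
assert (Hea : e <= a ^ 2) by (unfold e, d, a; nra).
assert (HW : 0 < W) by (unfold W; lra).
assert (HD : h ^ 2 * W <= W ^ 2 - e) by (unfold W in *; nra).
assert (HD0 : 0 < W ^ 2 - e) by nra.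
set (P0 := 20 * a ^ 2 + a * (10 * h ^ 4 - 10 * h ^ 2 - 20)
       + 2 * h ^ 6 - 25 * h ^ 2 + 28 * h).
(* [10 e C] is the exact change of [P0] when the end values [a + d] and [a - d] replace [a] and
   [a]. *)
set (C := 1 - h ^ 4 / W + 2 * W * (W - 1 + a) / (W ^ 2 - e)).
assert (Hid : gain A B h - (35 * h - 28 + 5 / 2 * (1 - A) * slope A B h
   + 5 / 2 * (1 - B) * slope B A h) = (P0 + 10 * (e * C)) / h).
{ assert (EA : A = a + d) by (unfold a, d; field).
  assert (EB : B = a - d) by (unfold a, d; field).
  unfold gain, slope, P0, C, e, W in *. clearbody a d. subst A B.
  clear - Hh Hh2 Ha HA HB HW HD0.
  field. repeat split; nra. }
assert (HP0 : 0 <= P0) by (apply gap_poly_nonneg; lra).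
cut (0 <= P0 + 10 * (e * C)).
{ intros H. assert (0 <= (P0 + 10 * (e * C)) / h) by (apply Rdiv_le_0_compat; lra). lra. }
(* The sign of the numerator decides which bound on [W ^ 2 - e] helps: at most [W ^ 2] in the first
   case, at least [h ^ 2 * W] in the second. *)
destruct (Rle_dec 0 (W - 1 + a)) as [Hc|Hc].
- assert (Ht : 2 * (W - 1 + a) / W <= 2 * W * (W - 1 + a) / (W ^ 2 - e)).
  { apply Rmult_le_reg_r with (W * (W ^ 2 - e)); [nra|].
    replace (2 * (W - 1 + a) / W * (W * (W ^ 2 - e))) with (2 * (W - 1 + a) * (W ^ 2 - e))
      by (field; lra).
    replace (2 * W * (W - 1 + a) / (W ^ 2 - e) * (W * (W ^ 2 - e)))
      with (2 * (W - 1 + a) * W ^ 2) by (field; lra).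
    nra. }
  set (M := 3 * h ^ 2 + 5 * a - h ^ 4 - 2).
  assert (HC : M / W <= C).
  { unfold C. replace (M / W) with (1 - h ^ 4 / W + 2 * (W - 1 + a) / W)
      by (unfold M, W; field; unfold W in HW; lra). lra. }
  assert (HeC : e * (M / W) <= e * C) by (apply Rmult_le_compat_l; lra).
  destruct (Rle_dec 0 M) as [HM|HM].
  + assert (0 <= M / W) by (apply Rdiv_le_0_compat; lra).
    assert (0 <= e * (M / W)) by (apply Rmult_le_pos; lra). lra.
  (* A negative [M] forces [h ^ 2 >= 2] here; then [P0 >= 20 a^2] outweighs [10 e C >= - 10 a^2]. *)
  + assert (H2 : 2 <= h ^ 2).
    { apply Rnot_lt_le; intros H2. apply HM. unfold M, W in *.
      replace (h ^ 4) with (h ^ 2 * h ^ 2) by ring. set (u := h ^ 2) in *. clearbody u.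
      destruct (Rle_dec u 1); nra. }
    pose proof (gap_poly_ge_square h a ltac:(lra) H2 ltac:(lra)) as HL. fold P0 in HL.
    assert (- 1 <= M / W).
    { apply Rmult_le_reg_r with W; [lra|]. replace (M / W * W) with M by (field; lra).
      unfold M, W. assert (h ^ 2 <= 81/25) by nra.
      replace (h ^ 4) with (h ^ 2 * h ^ 2) by ring. nra. }
    nra.
- assert (H1 : h ^ 4 / W <= 1).
  { apply Rmult_le_reg_r with W; [lra|]. replace (h ^ 4 / W * W) with (h ^ 2 * h ^ 2) by (field; lra).
    unfold W in *. nra. }
  assert (Ht : 2 * (W - 1 + a) / h ^ 2 <= 2 * W * (W - 1 + a) / (W ^ 2 - e)).
  { apply Rmult_le_reg_r with (h ^ 2 * (W ^ 2 - e)); [nra|].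
    replace (2 * (W - 1 + a) / h ^ 2 * (h ^ 2 * (W ^ 2 - e))) with (2 * (W - 1 + a) * (W ^ 2 - e))
      by (field; lra).
    replace (2 * W * (W - 1 + a) / (W ^ 2 - e) * (h ^ 2 * (W ^ 2 - e)))
      with (2 * (W - 1 + a) * (h ^ 2 * W)) by (field; lra).
    nra. }
  assert (HC : 2 * (W - 1 + a) / h ^ 2 <= C) by (unfold C; lra).
  assert (Hn : 2 * (W - 1 + a) / h ^ 2 <= 0).
  { apply Rmult_le_reg_r with (h ^ 2); [lra|].
    replace (2 * (W - 1 + a) / h ^ 2 * h ^ 2) with (2 * (W - 1 + a)) by (field; lra). lra. }
  assert (HeC : a ^ 2 * (2 * (W - 1 + a) / h ^ 2) <= e * C) by nra.
  assert (HG := gap_poly_ge_cubic h a ltac:(lra) ltac:(lra) ltac:(unfold W in Hc; lra)). fold P0 in HG.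
  assert (0 <= P0 + 10 * (a ^ 2 * (2 * (W - 1 + a) / h ^ 2))).
  { apply Rmult_le_reg_r with (h ^ 2); [lra|].
    replace ((P0 + 10 * (a ^ 2 * (2 * (W - 1 + a) / h ^ 2))) * h ^ 2)
     with (h ^ 2 * P0 + 20 * a ^ 2 * (W - 1 + a)) by (field; lra).
    unfold W. nra. }
  lra.
Qed.

Lemma clamp_le_max (k t : R) : clamp k t <= Rmax (- k) t.
Proof. apply Rle_max_compat_l, Rmin_r. Qed.

Lemma clamp_bounds (k t : R) : 0 <= k -> - k <= clamp k t <= k.
Proof.
intros Hk; unfold clamp; split; [apply Rmax_l|].
apply Rmax_lub; [lra|apply Rmin_l].
Qed.

Lemma clamp_opp (k s t : R) : 0 <= k -> s + t = 0 -> clamp k s + clamp k t = 0.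
Proof.
intros Hk Hst; unfold clamp, Rmax, Rmin.
repeat destruct Rle_dec; lra.
Qed.

(** Half the harmonic mean of [h ^ 2 + A] and [h ^ 2 + B] is at least [h ^ 2 / 2], with equality at
    [A = B = 0]. *)
Lemma gain_ge (A B h : R) : 0 < h -> 0 <= A -> 0 <= B -> 2 * h ^ 5 <= gain A B h.
Proof.
intros Hh HA HB. unfold gain.
assert (Hh2 : 0 < h ^ 2) by (apply pow_lt; lra).
assert (Hh3 : 0 < h ^ 3) by (apply pow_lt; lra).
assert (h ^ 2 / 2 <= (h ^ 2 + A) * (h ^ 2 + B) / (2 * h ^ 2 + A + B)).
{ apply Rmult_le_reg_r with (2 * h ^ 2 + A + B); [lra|].
  replace ((h ^ 2 + A) * (h ^ 2 + B) / (2 * h ^ 2 + A + B) * (2 * h ^ 2 + A + B))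
   with ((h ^ 2 + A) * (h ^ 2 + B)) by (field; lra). nra. }
replace (20 * h ^ 3 * ((h ^ 2 + A) * (h ^ 2 + B)) / (2 * h ^ 2 + A + B))
 with (20 * h ^ 3 * ((h ^ 2 + A) * (h ^ 2 + B) / (2 * h ^ 2 + A + B))) by (field; lra).
nra.
Qed.

(** Up to [h = 9/5] the lower clamp is inactive, so that clamping can only decrease the slope. *)
Lemma slope_ge (A B h : R) : 0 < h <= 9 / 5 -> 0 <= A -> 0 <= B <= 1 -> - (21 / 5) <= slope A B h.
Proof.
intros Hh HA HB. unfold slope.
assert (Hh2 : 0 < h ^ 2) by (apply pow_lt; lra).
apply Rmult_le_reg_r with (h * (h ^ 2 + B)); [nra|].
replace (((h ^ 2 + A) ^ 2 / (h ^ 2 + B) + 3 * A - 3 * h ^ 2) / h * (h * (h ^ 2 + B)))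
 with ((h ^ 2 + A) ^ 2 + (3 * A - 3 * h ^ 2) * (h ^ 2 + B)) by (field; lra).
assert (0 <= 21/5 * h + 21/5 * h * h^2 - 2 * h^4 - 3 * h^2).
{ replace (21/5 * h + 21/5 * h * h^2 - 2 * h^4 - 3 * h^2) with
   (h * (21/5 * (1 + h^2) - 2*h^3-3*h)) by ring.
  apply Rmult_le_pos; [lra|].
  assert (0 <= (9/5 - h) * h^2) by nra. nra. }
assert (0 <= (1 - B) * (3 * h ^ 2)) by nra.
assert (21/5 * h <= 3 * h ^ 2 \/ 3 * h ^ 2 <= 21/5 * h) as [|] by lra; nra.
Qed.

Lemma slope_nonpos (A B h : R) : 9 / 5 <= h -> 0 <= A <= 1 -> 0 <= B -> slope A B h <= 0.
Proof.
intros Hh HA HB. unfold slope.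
assert (Hh2 : 81/25 <= h ^ 2) by nra.
apply Rmult_le_reg_r with (h * (h ^ 2 + B)); [nra|].
replace (((h ^ 2 + A) ^ 2 / (h ^ 2 + B) + 3 * A - 3 * h ^ 2) / h * (h * (h ^ 2 + B)))
 with ((h ^ 2 + A) ^ 2 + (3 * A - 3 * h ^ 2) * (h ^ 2 + B)) by (field; lra).
set (u := h ^ 2) in *. clearbody u. nra.
Qed.

Lemma clamped_small (A B h : R) : 0 < h <= 9 / 20 -> 0 <= B <= A -> A <= 1 ->
  5 / 2 * (1 - A) * clamp (21 / 5) (slope A B h)
   + 5 / 2 * (1 - B) * clamp (21 / 5) (slope B A h) <= 28 - 35 * h.
Proof.
intros Hh HB HA.
assert (Hh2 : 0 < h ^ 2) by (apply pow_lt; lra).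
pose proof (clamp_bounds (21/5) (slope A B h) ltac:(lra)) as H1.
pose proof (clamp_bounds (21/5) (slope B A h) ltac:(lra)) as H2.
assert (Hs : slope B A h <= 4 * B / h).
{ unfold slope. apply Rmult_le_compat_r; [left; apply Rinv_0_lt_compat; lra|].
  assert ((h ^ 2 + B) ^ 2 / (h ^ 2 + A) <= h ^ 2 + B).
  { apply Rmult_le_reg_r with (h ^ 2 + A); [lra|].
    replace ((h ^ 2 + B) ^ 2 / (h ^ 2 + A) * (h ^ 2 + A)) with ((h ^ 2 + B) ^ 2) by (field; lra).
    nra. }
  lra. }
pose proof (clamp_le_max (21/5) (slope B A h)) as H3.
set (p := clamp (21/5) (slope A B h)) in *. set (q := clamp (21/5) (slope B A h)) in *.
assert ((1 - A) * p <= (1 - B) * (21/5)) by nra.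
destruct (Rle_dec q 0) as [Hq|Hq]; [nra|].
assert (Hq' : q <= 4 * B / h).
{ revert H3. unfold Rmax. destruct Rle_dec; lra. }
assert (HB' : q * h / 4 <= B).
{ apply Rmult_le_reg_r with (4 / h); [apply Rdiv_lt_0_compat; lra|].
  replace (q * h / 4 * (4 / h)) with q by (field; lra).
  replace (B * (4 / h)) with (4 * B / h) by (field; lra). lra. }
assert ((1 - B) * (21/5 + q) <= (1 - q * h / 4) * (21/5 + q)) by nra.
assert (5/2 * ((1 - q * h / 4) * (21/5 + q)) <= 28 - 35 * h).
(* [23/10] is close to the maximiser in [q] at [h = 9/20], the tight case. *)
{ assert (0 <= (q - 23/10)^2) by apply pow2_ge_0. nra. }
nra.
Qed.

(* [35 h - 28] is the tangent at [h = 1] of [gain (1/2 h^2) (1/2 h^2) h = 7 h^5].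
   The multiplier [5/2 (1 - A)] is chosen to make the unclamped difference
   stationary at [h = 1], [A = B = 1/2] and to vanish at the cap [A = 1].  The clamp
   is needed for short gaps; as it is odd, the terms cancel at a node without jump. *)
Lemma gap_inequality (A B h : R) : 0 < h -> 0 <= A <= 1 -> 0 <= B <= 1 ->
  35 * h - 28 + 5 / 2 * (1 - A) * clamp (21 / 5) (slope A B h)
   + 5 / 2 * (1 - B) * clamp (21 / 5) (slope B A h) <= gain A B h.
Proof.
intros Hh HA HB.
pose proof (gain_ge A B h Hh ltac:(lra) ltac:(lra)) as Hg.
assert (H5 : 0 < h ^ 5) by (apply pow_lt; lra).
destruct (Rle_dec h (9/20)) as [H1|H1].
{ destruct (Rle_dec B A).
  - pose proof (clamped_small A B h ltac:(lra) ltac:(lra) ltac:(lra)). lra.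
  - pose proof (clamped_small B A h ltac:(lra) ltac:(lra) ltac:(lra)). lra. }
pose proof (clamp_le_max (21/5) (slope A B h)) as HcA.
pose proof (clamp_le_max (21/5) (slope B A h)) as HcB.
destruct (Rle_dec h (9/5)) as [H2|H2].
- rewrite Rmax_right in HcA by (apply slope_ge; lra).
  rewrite Rmax_right in HcB by (apply slope_ge; lra).
  pose proof (unclamped_nonneg A B h ltac:(lra) HA HB). nra.
(* For long gaps both slopes are nonpositive, and [2 h^5], bounded below by a tangent at [9/5],
   suffices. *)
- assert (HcA' : clamp (21/5) (slope A B h) <= 0).
  { eapply Rle_trans; [exact HcA|]. apply Rmax_lub; [lra|apply slope_nonpos; lra]. }
  assert (HcB' : clamp (21/5) (slope B A h) <= 0).
  { eapply Rle_trans; [exact HcB|]. apply Rmax_lub; [lra|apply slope_nonpos; lra]. }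
  assert (35 * h - 28 <= 2 * h ^ 5).
  { assert (0 <= (h - 9/5)^2 * (h^3+2*(9/5)*h^2+3*(9/5)^2*h+4*(9/5)^3)).
    { apply Rmult_le_pos; [apply pow2_ge_0|].
      assert (0 < h^3) by (apply pow_lt; lra). nra. }
    nra. }
  nra.
Qed.

(** * The largest admissible sequence *)

(** A one-sided Lipschitz constant of [slope] in its first argument: [(h^2 + A)^2] grows by at most
    [(2 h^2 + 3) d] for [A] and [d] in [[0, 1]]. *)
Definition slope_lip (h : R) : R := ((2 * h ^ 2 + 3) / h ^ 2 + 3) / h.

Lemma slope_lip_pos (h : R) : 0 < h -> 0 < slope_lip h.
Proof.
intros Hh. unfold slope_lip. assert (Hh2 : 0 < h ^ 2) by (apply pow_lt; lra).
apply Rdiv_lt_0_compat; [|lra].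
assert (0 < (2 * h ^ 2 + 3) / h ^ 2) by (apply Rdiv_lt_0_compat; lra). lra.
Qed.

Lemma slope_add_le (A B h d : R) : 0 < h -> 0 <= A <= 1 -> 0 <= B -> 0 <= d <= 1 ->
  slope (A + d) B h <= slope A B h + slope_lip h * d.
Proof.
intros Hh HA HB Hd. unfold slope, slope_lip.
assert (Hh2 : 0 < h ^ 2) by (apply pow_lt; lra).
replace (((h ^ 2 + A) ^ 2 / (h ^ 2 + B) + 3 * A - 3 * h ^ 2) / h + ((2 * h ^ 2 + 3) / h ^ 2 + 3) / h * d)
 with (((h ^ 2 + A) ^ 2 / (h ^ 2 + B) + (2 * h ^ 2 + 3) / h ^ 2 * d + 3 * (A + d) - 3 * h ^ 2) / h)
 by (field; lra).
apply Rmult_le_compat_r; [left; apply Rinv_0_lt_compat; lra|].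
assert ((h ^ 2 + (A + d)) ^ 2 / (h ^ 2 + B)
  <= (h ^ 2 + A) ^ 2 / (h ^ 2 + B) + (2 * h ^ 2 + 3) / h ^ 2 * d); [|lra].
replace ((h ^ 2 + (A + d)) ^ 2 / (h ^ 2 + B))
 with ((h ^ 2 + A) ^ 2 / (h ^ 2 + B) + (2 * (h ^ 2 + A) + d) * d / (h ^ 2 + B)) by (field; lra).
apply Rplus_le_compat_l.
replace ((2 * h ^ 2 + 3) / h ^ 2 * d) with ((2 * h ^ 2 + 3) * d / h ^ 2) by (field; lra).
apply Rmult_le_compat; [nra|left; apply Rinv_0_lt_compat; lra|nra|apply Rinv_le_contravar; lra].
Qed.

Lemma slope_anti (A B B' h : R) : 0 < h -> 0 <= B <= B' -> slope A B' h <= slope A B h.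
Proof.
intros Hh HB. unfold slope.
assert (Hh2 : 0 < h ^ 2) by (apply pow_lt; lra).
apply Rmult_le_compat_r; [left; apply Rinv_0_lt_compat; lra|].
assert ((h ^ 2 + A) ^ 2 / (h ^ 2 + B') <= (h ^ 2 + A) ^ 2 / (h ^ 2 + B)); [|lra].
apply Rmult_le_compat_l; [apply pow2_ge_0|]. apply Rinv_le_contravar; lra.
Qed.

(** Makes the zero sequence admissible, so that suprema can be taken. *)
Lemma slope_0_neg (B h : R) : 0 < h -> 0 <= B -> slope 0 B h <= 0.
Proof.
intros Hh HB. unfold slope.
assert (Hh2 : 0 < h ^ 2) by (apply pow_lt; lra).
apply Rmult_le_reg_r with (h * (h ^ 2 + B)); [nra|].
replace (((h ^ 2 + 0) ^ 2 / (h ^ 2 + B) + 3 * 0 - 3 * h ^ 2) / h * (h * (h ^ 2 + B)))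
 with ((h ^ 2) ^ 2 - 3 * h ^ 2 * (h ^ 2 + B)) by (field; lra).
nra.
Qed.

(* Twelve times the upward jump of the third derivative at node [S k] with value [x]. *)
Definition kink (h a : nat -> R) (x : R) (k : nat) : R :=
  slope x (a k) (h k) + slope x (a (S (S k))) (h (S k)).

Definition admissible (h : nat -> R) (M : nat) (a : nat -> R) : Prop :=
  (forall i, 0 <= a i <= 1) /\
  (forall k, (S k < M)%nat -> kink h a (a (S k)) k <= 0).

Definition kink_lip (h : nat -> R) (k : nat) : R := slope_lip (h k) + slope_lip (h (S k)).

Lemma kink_add_le (h a : nat -> R) (x d : R) (k : nat) :
  (forall i, 0 < h i) -> (forall i, 0 <= a i) -> 0 <= x <= 1 -> 0 <= d <= 1 ->
  kink h a (x + d) k <= kink h a x k + kink_lip h k * d.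
Proof.
intros Hh Ha Hx Hd. unfold kink, kink_lip.
pose proof (slope_add_le x (a k) (h k) d (Hh k) Hx (Ha k) Hd).
pose proof (slope_add_le x (a (S (S k))) (h (S k)) d (Hh _) Hx (Ha _) Hd). lra.
Qed.

Lemma kink_anti (h a b : nat -> R) (x : R) (k : nat) :
  (forall i, 0 < h i) -> (forall i, 0 <= a i <= b i) -> kink h b x k <= kink h a x k.
Proof.
intros Hh Ha. apply Rplus_le_compat; apply slope_anti; auto.
Qed.

(* The pointwise supremum of the admissible sequences; monotonicity of [slope]
   makes it admissible, and it then cannot be raised at any index. *)
Lemma maximal_admissible (h : nat -> R) (M : nat) : (forall i, 0 < h i) ->
  exists a : nat -> R, admissible h M a /\
    forall i, a i = 1 \/ exists k, i = S k /\ (S k < M)%nat /\ kink h a (a i) k = 0.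
Proof.
intros Hh.
set (E := fun i x => exists a, admissible h M a /\ x = a i).
assert (Z : admissible h M (fun _ => 0)).
{ split; [intros; lra|]. intros k _. unfold kink.
  pose proof (slope_0_neg 0 (h k) (Hh k) (Rle_refl _)).
  pose proof (slope_0_neg 0 (h (S k)) (Hh _) (Rle_refl _)). lra. }
assert (Hb : forall i, bound (E i)).
{ intros i. exists 1. intros x (a & Ha & ->). apply Ha. }
assert (Hne : forall i, exists x, E i x) by (intros i; exists 0, (fun _ => 0); auto).
set (A := fun i => proj1_sig (completeness (E i) (Hb i) (Hne i))).
assert (HA : forall i, is_lub (E i) (A i))
  by (intros i; unfold A; apply (proj2_sig (completeness _ _ _))).
assert (HleA : forall a i, admissible h M a -> a i <= A i)
  by (intros a i Ha; apply HA; exists a; auto).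
assert (HA01 : forall i, 0 <= A i <= 1).
{ intros i; split.
  - apply (HleA _ i Z).
  - apply HA. intros x (a & Ha & ->). apply Ha. }
assert (HAadm : admissible h M A).
{ split; [exact HA01|]. intros k Hk.
  assert (HL : 0 < kink_lip h k)
    by (unfold kink_lip; pose proof (slope_lip_pos _ (Hh k)); pose proof (slope_lip_pos _ (Hh (S k))); lra).
  apply Rnot_lt_le; intros Hc.
  (* Raising the node by less than [eps] increases the kink by at most half of its supposed positive
     value, while larger neighbours only lower it. *)
  set (eps := Rmin 1 (kink h A (A (S k)) k / (2 * kink_lip h k))).
  assert (Heps : 0 < eps) by (unfold eps; apply Rmin_glb_lt; [lra|apply Rdiv_lt_0_compat; lra]).
  assert (exists a, admissible h M a /\ A (S k) - eps < a (S k)) as (a & Ha & Hclose).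
  { apply NNPP; intros Hno. assert (A (S k) <= A (S k) - eps); [|lra].
    apply HA. intros x (a & Ha & ->). apply Rnot_lt_le. intros Hlt. apply Hno. exists a; auto. }
  pose proof (HleA a (S k) Ha) as Hle.
  pose proof (proj2 Ha k Hk) as Hak.
  assert (Hab : forall i, 0 <= a i <= A i)
    by (intros i; split; [apply (proj1 Ha i)|apply HleA, Ha]).
  pose proof (kink_anti h a A (a (S k)) k Hh Hab) as H1.
  pose proof (proj1 Ha (S k)) as Hak1. pose proof (HA01 (S k)) as HAk1.
  pose proof (kink_add_le h A (a (S k)) (A (S k) - a (S k)) k Hh
    (fun i => proj1 (HA01 i)) Hak1 ltac:(lra)) as H2.
  replace (a (S k) + (A (S k) - a (S k))) with (A (S k)) in H2 by ring.
  assert (kink_lip h k * (A (S k) - a (S k)) <= kink_lip h k * eps)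
    by (apply Rmult_le_compat_l; lra).
  assert (kink_lip h k * eps <= kink h A (A (S k)) k / 2).
  { replace (kink h A (A (S k)) k / 2) with
      (kink_lip h k * (kink h A (A (S k)) k / (2 * kink_lip h k))) by (field; lra).
    apply Rmult_le_compat_l; [lra|apply Rmin_r]. }
  lra. }
(* Raising one entry relaxes the conditions at the other nodes, so only its own condition has to be
   checked again. *)
assert (Hbump : forall i d, 0 < d -> A i + d <= 1 ->
  (forall k, i = S k -> (S k < M)%nat -> kink h A (A i + d) k <= 0) -> False).
{ intros i d Hd Hd1 Hk0.
  set (A' := fun j => if Nat.eq_dec j i then A i + d else A j).
  assert (HA'A : forall j, 0 <= A j <= A' j).
  { intros j. unfold A'. pose proof (HA01 j). destruct Nat.eq_dec as [->|]; lra. }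
  assert (Hadm' : admissible h M A').
  { split.
    - intros j. unfold A'. pose proof (HA01 j). pose proof (HA01 i). destruct Nat.eq_dec; lra.
    - intros k Hk. apply Rle_trans with (kink h A (A' (S k)) k).
      + apply kink_anti; auto.
      + unfold A'. destruct Nat.eq_dec as [e|]; [apply Hk0; auto|apply HAadm, Hk]. }
  pose proof (HleA A' i Hadm') as H. unfold A' in H.
  destruct Nat.eq_dec; [lra|congruence]. }
exists A. split; [exact HAadm|]. intros i.
pose proof (HA01 i) as Hi.
destruct (Req_dec (A i) 1) as [|Hne1]; [left; assumption|right].
apply NNPP; intros Hno.
assert (Hi1 : A i < 1) by lra.
destruct (classic (exists k, i = S k /\ (S k < M)%nat)) as [(k & Ek & Hk)|Hnk].
- assert (Hneg : kink h A (A i) k < 0).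
  { pose proof (proj2 HAadm k Hk) as H. rewrite <- Ek in H.
    destruct (Rle_lt_or_eq_dec _ _ H) as [|E0]; [assumption|].
    exfalso; apply Hno; exists k; auto. }
  assert (HL : 0 < kink_lip h k)
    by (unfold kink_lip; pose proof (slope_lip_pos _ (Hh k)); pose proof (slope_lip_pos _ (Hh (S k))); lra).
  assert (Hd0 : 0 < - kink h A (A i) k / kink_lip h k) by (apply Rdiv_lt_0_compat; lra).
  set (d := Rmin (1 - A i) (- kink h A (A i) k / kink_lip h k)).
  assert (Hd : 0 < d) by (apply Rmin_glb_lt; lra).
  assert (Hd1 : d <= 1 - A i) by apply Rmin_l.
  apply (Hbump i d); [lra|lra|].
  intros k' Ek' _. assert (k' = k) by congruence. subst k'.
  pose proof (kink_add_le h A (A i) d k Hh (fun i => proj1 (HA01 i)) Hi ltac:(lra)).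
  assert (kink_lip h k * d <= - kink h A (A i) k).
  { replace (- kink h A (A i) k) with (kink_lip h k * (- kink h A (A i) k / kink_lip h k))
      by (field; lra).
    apply Rmult_le_compat_l; [lra|apply Rmin_r]. }
  lra.
- apply (Hbump i (1 - A i)); [lra|lra|].
  intros k Ek Hk; exfalso; apply Hnk; exists k; auto.
Qed.

(** Summation of [gap_inequality]. At each inner node the two multiplier terms cancel, by the
    dichotomy in [maximal_admissible]; both end values sit at the cap, where the multiplier is
    zero. *)
Lemma total_gain_ge (h : nat -> R) (m : nat) : (forall i, 0 < h i) ->
  exists a : nat -> R, admissible h (S m) a /\
    35 * sum_f_R0 h m - 28 * INR (S m) <= sum_f_R0 (fun i => gain (a i) (a (S i)) (h i)) m.
Proof.
intros Hh.
destruct (maximal_admissible h (S m) Hh) as (a & Ha & Hmax).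
exists a; split; [exact Ha|].
pose proof (proj1 Ha) as Ha01.
assert (H0 : a O = 1).
{ destruct (Hmax O) as [|(k & Ek & _)]; [assumption|discriminate]. }
assert (Hm : a (S m) = 1).
{ destruct (Hmax (S m)) as [|(k & Ek & Hk & _)]; [assumption|]. exfalso; lia. }
(* The partial sums carry the still unmatched multiplier term of their last node. *)
assert (Hind : forall i, (i <= m)%nat ->
  35 * sum_f_R0 h i - 28 * INR (S i)
   + 5 / 2 * (1 - a (S i)) * clamp (21 / 5) (slope (a (S i)) (a i) (h i))
  <= sum_f_R0 (fun i => gain (a i) (a (S i)) (h i)) i).
{ induction i as [|i IH]; intros Hi.
  - simpl. pose proof (gap_inequality (a O) (a 1%nat) (h O) (Hh _) (Ha01 _) (Ha01 _)) as H.
    rewrite H0 in *. lra.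
  - specialize (IH ltac:(lia)). rewrite !tech5.
    pose proof (gap_inequality (a (S i)) (a (S (S i))) (h (S i)) (Hh _) (Ha01 _) (Ha01 _)) as H.
    rewrite (S_INR (S i)).
    assert (Hz : 5 / 2 * (1 - a (S i)) * clamp (21 / 5) (slope (a (S i)) (a i) (h i))
      + 5 / 2 * (1 - a (S i)) * clamp (21 / 5) (slope (a (S i)) (a (S (S i))) (h (S i))) = 0).
    { destruct (Hmax (S i)) as [E1|(k & Ek & Hk & E0)].
      - rewrite E1; ring.
      - injection Ek as <-. rewrite <- Rmult_plus_distr_l.
        rewrite clamp_opp; [ring|lra|exact E0]. }
    lra. }
specialize (Hind m (le_n _)). rewrite Hm in Hind. lra.
Qed.

(** * Truncated powers and remainders *)

Definition pos_part (x : R) : R := Rmax 0 x.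

Lemma pos_part_right (x : R) : 0 <= x -> pos_part x = x.
Proof. intros; unfold pos_part; apply Rmax_right; lra. Qed.

Lemma pos_part_left (x : R) : x <= 0 -> pos_part x = 0.
Proof. intros; unfold pos_part; apply Rmax_left; lra. Qed.

Lemma pos_part_ge0 (x : R) : 0 <= pos_part x.
Proof. apply Rmax_l. Qed.

Lemma pos_part_le_abs (x : R) : pos_part x <= Rabs x.
Proof. unfold pos_part; apply Rmax_lub; [apply Rabs_pos|apply Rle_abs]. Qed.

(** Exponents start at 2, so that the derivative exists at the corner, where the difference quotient
    is bounded by [|h|]. *)
Lemma is_derive_pos_pow (k : nat) (x : R) :
  is_derive (fun y => pos_part y ^ S (S k)) x (INR (S (S k)) * pos_part x ^ S k).
Proof.
destruct (total_order_T x 0) as [[Hx|Hx]|Hx].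
- apply is_derive_ext_loc with (fun _ => 0).
  + assert (Hd : 0 < - x) by lra. exists (mkposreal _ Hd). intros y Hy.
    unfold ball in Hy; simpl in Hy. unfold AbsRing_ball, abs, minus, plus, opp in Hy; simpl in Hy.
    apply Rabs_def2 in Hy. rewrite pos_part_left by lra. simpl; ring.
  + rewrite pos_part_left by lra.
    replace (INR (S (S k)) * 0 ^ S k) with 0 by (simpl; ring). apply (is_derive_const 0).
- subst x. rewrite pos_part_left by lra.
  replace (INR (S (S k)) * 0 ^ S k) with 0 by (rewrite pow_i by lia; ring).
  apply is_derive_Reals. intros eps Heps.
  assert (Hd : 0 < Rmin 1 eps) by (apply Rmin_glb_lt; lra).
  exists (mkposreal _ Hd). simpl. intros h Hh Hlt.
  rewrite Rplus_0_l, (pos_part_left 0) by lra.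
  replace (pos_part h * (pos_part h * pos_part h ^ k) - 0 * (0 * 0 ^ k))
    with (pos_part h * (pos_part h * pos_part h ^ k)) by ring.
  assert (H1 : Rabs h < 1) by (eapply Rlt_le_trans; [exact Hlt|apply Rmin_l]).
  assert (H2 : Rabs h < eps) by (eapply Rlt_le_trans; [exact Hlt|apply Rmin_r]).
  pose proof (pos_part_ge0 h) as H3. pose proof (pos_part_le_abs h) as H4.
  assert (H5 : 0 <= pos_part h ^ k <= 1).
  { split; [apply pow_le; lra|]. rewrite <- (pow1 k). apply pow_incr; lra. }
  rewrite Rminus_0_r. unfold Rdiv. rewrite Rabs_mult, Rabs_inv.
  rewrite (Rabs_pos_eq (_ * _)) by (repeat apply Rmult_le_pos; lra).
  assert (Hh0 : 0 < Rabs h) by (apply Rabs_pos_lt; auto).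
  apply Rle_lt_trans with (Rabs h * (Rabs h * 1) * / Rabs h).
  + apply Rmult_le_compat_r; [left; apply Rinv_0_lt_compat; lra|].
    apply Rmult_le_compat; try lra; [apply Rmult_le_pos; lra|].
    apply Rmult_le_compat; lra.
  + replace (Rabs h * (Rabs h * 1) * / Rabs h) with (Rabs h) by (field; lra). exact H2.
- apply is_derive_ext_loc with (fun y => y ^ S (S k)).
  + exists (mkposreal _ Hx). intros y Hy.
    unfold ball in Hy; simpl in Hy. unfold AbsRing_ball, abs, minus, plus, opp in Hy; simpl in Hy.
    apply Rabs_def2 in Hy. rewrite pos_part_right by lra. reflexivity.
  + rewrite pos_part_right by lra.
    replace (INR (S (S k)) * x ^ S k) with (INR (S (S k)) * 1 * x ^ pred (S (S k))) by (simpl; ring).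
    apply (is_derive_pow (fun y => y)). apply (is_derive_id x).
Qed.

Lemma is_derive_shift (f : R -> R) (t x l : R) :
  is_derive f (x - t) l -> is_derive (fun y => f (y - t)) x l.
Proof.
intros H. replace l with (scal 1 l) by (apply (scal_one l)).
apply (is_derive_comp f (fun y => y - t)); [exact H|].
auto_derive; auto; ring.
Qed.

Lemma is_derive_pos_pow_shift (k : nat) (t x : R) :
  is_derive (fun y => pos_part (y - t) ^ S (S k)) x (INR (S (S k)) * pos_part (x - t) ^ S k).
Proof. apply (is_derive_shift (fun y => pos_part y ^ S (S k))), is_derive_pos_pow. Qed.

Lemma continuous_pos_part (x : R) : continuous pos_part x.
Proof.
apply continuity_pt_filterlim. apply continuity_pt_ext with (fun y => (y + Rabs y) / 2).
- intros y. unfold pos_part, Rmax, Rabs. destruct Rle_dec, Rcase_abs; lra.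
- apply continuity_pt_filterlim.
  apply (continuous_mult (fun y => y + Rabs y) (fun _ => / 2)); [|apply continuous_const].
  apply (continuous_plus (fun y => y) Rabs); [apply continuous_id|apply continuous_Rabs].
Qed.

Lemma continuous_pos_part_shift (t x : R) : continuous (fun y => pos_part (y - t)) x.
Proof.
apply (continuous_comp (fun y => y - t) pos_part); [|apply continuous_pos_part].
apply (continuous_minus (fun y => y) (fun _ => t)); [apply continuous_id|apply continuous_const].
Qed.

Lemma D_in_of_is_derive (f f' : R -> R) (D : R -> Prop) (x : R) :
  is_derive f x (f' x) -> D_in f f' D x.
Proof.
intros H. apply is_derive_Reals in H. intros eps Heps.
destruct (H eps Heps) as (d & Hd). exists d. split; [apply (cond_pos d)|].
intros y [[_ Hyx] Hdist]. simpl in *. unfold Rdist in *.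
specialize (Hd (y - x) ltac:(lra) Hdist).
replace (x + (y - x)) with y in Hd by ring. exact Hd.
Qed.

Lemma continue_in_of_continuous (f : R -> R) (D : R -> Prop) (x : R) :
  continuous f x -> continue_in f D x.
Proof.
intros H. apply continuity_pt_filterlim in H. intros eps Heps.
destruct (H eps Heps) as (d & Hd & Hc). exists d. split; [exact Hd|].
intros y [[_ Hyx] Hdist]. apply Hc. split; [split; [exact I|exact Hyx]|exact Hdist].
Qed.

(** The global counterpart of [C_on 4]: two-sided derivatives on the whole line, each one named. *)
Definition C4 (f f1 f2 f3 g : R -> R) : Prop :=
  (forall x, is_derive f x (f1 x)) /\ (forall x, is_derive f1 x (f2 x)) /\
  (forall x, is_derive f2 x (f3 x)) /\ (forall x, is_derive f3 x (g x)) /\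
  (forall x, continuous g x).

Lemma C_on_of_C4 (f f1 f2 f3 g : R -> R) : C4 f f1 f2 f3 g -> C_on 4 f g.
Proof.
intros (H0 & H1 & H2 & H3 & Hg). split.
- exists f1; split; [intros; apply D_in_of_is_derive, H0|].
  exists f2; split; [intros; apply D_in_of_is_derive, H1|].
  exists f3; split; [intros; apply D_in_of_is_derive, H2|].
  exists g; split; [intros; apply D_in_of_is_derive, H3|].
  intros x _; reflexivity.
- intros x _; apply continue_in_of_continuous, Hg.
Qed.

Lemma C4_lin (u v : R) (f f1 f2 f3 g p p1 p2 p3 q : R -> R) :
  C4 f f1 f2 f3 g -> C4 p p1 p2 p3 q ->
  C4 (fun x => u * f x + v * p x) (fun x => u * f1 x + v * p1 x)
     (fun x => u * f2 x + v * p2 x) (fun x => u * f3 x + v * p3 x)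
     (fun x => u * g x + v * q x).
Proof.
intros (F0 & F1 & F2 & F3 & Fg) (P0 & P1 & P2 & P3 & Pq).
assert (L : forall k l k' l' : R -> R, (forall x, is_derive k x (k' x)) ->
   (forall x, is_derive l x (l' x)) ->
   forall x, is_derive (fun x => u * k x + v * l x) x (u * k' x + v * l' x)).
{ intros k l k' l' Hk Hl x.
  apply (is_derive_plus (fun x => u * k x) (fun x => v * l x));
   apply is_derive_scal; auto. }
split; [|split; [|split; [|split]]]; auto.
intros x. apply (continuous_plus (fun x => u * g x) (fun x => v * q x)).
- apply (continuous_mult (fun _ => u) g); [apply continuous_const|auto].
- apply (continuous_mult (fun _ => v) q); [apply continuous_const|auto].
Qed.

(** Five is the least exponent for which a truncated power has a continuous fourth derivative. *)
Lemma C4_pos_pow5 (t : R) : C4 (fun x => pos_part (x - t) ^ 5) (fun x => 5 * pos_part (x - t) ^ 4)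
  (fun x => 20 * pos_part (x - t) ^ 3) (fun x => 60 * pos_part (x - t) ^ 2)
  (fun x => 120 * pos_part (x - t)).
Proof.
split; [|split; [|split; [|split]]]; intros x.
- pose proof (is_derive_pos_pow_shift 3 t x) as H.
  replace (5 * pos_part (x - t) ^ 4) with (INR 5 * pos_part (x - t) ^ 4) by (simpl; ring). exact H.
- pose proof (is_derive_scal _ _ 5 _ (is_derive_pos_pow_shift 2 t x)) as H.
  replace (20 * pos_part (x - t) ^ 3) with (5 * (INR 4 * pos_part (x - t) ^ 3)) by (simpl; ring). exact H.
- pose proof (is_derive_scal _ _ 20 _ (is_derive_pos_pow_shift 1 t x)) as H.
  replace (60 * pos_part (x - t) ^ 2) with (20 * (INR 3 * pos_part (x - t) ^ 2)) by (simpl; ring). exact H.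
- pose proof (is_derive_scal _ _ 60 _ (is_derive_pos_pow_shift 0 t x)) as H.
  replace (120 * pos_part (x - t)) with (60 * (INR 2 * pos_part (x - t) ^ 1)) by (simpl; ring). exact H.
- apply (continuous_mult (fun _ => 120) (fun x => pos_part (x - t)));
   [apply continuous_const|apply continuous_pos_part_shift].
Qed.

Lemma C4_quartic (c0 c1 c2 c3 c4 : R) :
  C4 (fun x => c0 + c1 * x + c2 * x ^ 2 / 2 + c3 * x ^ 3 / 6 + c4 * x ^ 4 / 24)
     (fun x => c1 + c2 * x + c3 * x ^ 2 / 2 + c4 * x ^ 3 / 6)
     (fun x => c2 + c3 * x + c4 * x ^ 2 / 2) (fun x => c3 + c4 * x) (fun _ => c4).
Proof.
split; [|split; [|split; [|split]]]; intros x;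
 try (auto_derive; auto; field); apply continuous_const.
Qed.

Lemma ex_RInt_cont (f : R -> R) (a b : R) : (forall x, continuous f x) -> ex_RInt f a b.
Proof. intros H; apply (ex_RInt_continuous (V := R_CompleteNormedModule)); intros; apply H. Qed.

Lemma continuous_of_derive (f f' : R -> R) : (forall x, is_derive f x (f' x)) ->
  forall x, continuous f x.
Proof. intros H x; apply (ex_derive_continuous (V := R_NormedModule)); exists (f' x); apply H. Qed.

Lemma remainder_lin (N : nat) (Q : (R -> R) -> R) (u v : R) (f g : R -> R) :
  is_quadrature N Q -> (forall x, continuous f x) -> (forall x, continuous g x) ->
  remainder Q (fun x => u * f x + v * g x) = u * remainder Q f + v * remainder Q g.
Proof.
intros (tau & a & _ & _ & HQ) Hf Hg. unfold remainder. rewrite !HQ.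
pose proof (ex_RInt_cont f 0 1 Hf) as If. pose proof (ex_RInt_cont g 0 1 Hg) as Ig.
assert (E1 : RInt (fun x => u * f x + v * g x) 0 1 = u * RInt f 0 1 + v * RInt g 0 1).
{ apply is_RInt_unique.
  apply (is_RInt_plus (fun x => u * f x) (fun x => v * g x));
   apply (is_RInt_scal (V := R_NormedModule)); apply (RInt_correct (V := R_CompleteNormedModule)); auto. }
assert (E2 : sum_n_m (fun i => a i * (u * f (tau i) + v * g (tau i))) 1 N =
   u * sum_n_m (fun i => a i * f (tau i)) 1 N + v * sum_n_m (fun i => a i * g (tau i)) 1 N).
{ rewrite <- !(sum_n_m_mult_l (K := R_Ring)). rewrite <- (sum_n_m_plus (G := R_AbelianMonoid)).
  apply sum_n_m_ext. intros i. unfold plus, mult; simpl. ring. }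
rewrite E1, E2. ring.
Qed.

(** Boundedness of the remainder in the sup norm: one for the integral plus the total absolute
    weight. *)
Lemma remainder_small (N : nat) (Q : (R -> R) -> R) : is_quadrature N Q ->
  exists C, 0 <= C /\ forall f d, (forall x, continuous f x) ->
    (forall x, 0 <= x <= 1 -> Rabs (f x) <= d) -> Rabs (remainder Q f) <= C * d.
Proof.
intros (tau & a & Hr & _ & HQ).
exists (1 + sum_n_m (fun i => Rabs (a i)) 1 N).
assert (Hs : forall n, (n <= N)%nat -> 0 <= sum_n_m (fun i => Rabs (a i)) 1 n /\
  forall f d, (forall x, 0 <= x <= 1 -> Rabs (f x) <= d) ->
  Rabs (sum_n_m (fun i => a i * f (tau i)) 1 n) <= sum_n_m (fun i => Rabs (a i)) 1 n * d).
{ induction n as [|n IH]; intros Hn.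
  - rewrite !sum_n_m_zero by lia. split; [apply Rle_refl|]. intros f d _.
    rewrite sum_n_m_zero by lia. unfold zero; simpl. rewrite Rabs_R0. lra.
  - destruct (IH ltac:(lia)) as [IH0 IH1]. rewrite !sum_n_Sm by lia. unfold plus; simpl.
    pose proof (Rabs_pos (a (S n))) as Ha. split; [lra|]. intros f d Hd.
    rewrite sum_n_Sm by lia. unfold plus; simpl.
    eapply Rle_trans; [apply Rabs_triang|]. rewrite Rmult_plus_distr_r.
    apply Rplus_le_compat; [apply IH1, Hd|]. rewrite Rabs_mult.
    apply Rmult_le_compat_l; [exact Ha|]. apply Hd, Hr; lia. }
destruct (Hs N (le_n _)) as [H0 H1]. split; [lra|].
intros f d Hf Hd. unfold remainder. rewrite HQ.
assert (HI : Rabs (RInt f 0 1) <= d).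
{ pose proof (ex_RInt_cont f 0 1 Hf) as If.
  pose proof (abs_RInt_le_const f 0 1 d ltac:(lra) If Hd) as H. lra. }
eapply Rle_trans; [apply Rabs_triang|]. rewrite Rabs_Ropp.
specialize (H1 f d Hd). lra.
Qed.

(** [20 y^3] is the second derivative of [y^5]. For [y >= e] the error is exactly [y e^2 / 2];
    otherwise every term is of order [e^3] or zero. *)
Lemma second_difference_pow5 (y e : R) : 0 < e <= 1 -> y <= 1 ->
  Rabs ((pos_part (y + e) ^ 5 - 2 * pos_part y ^ 5 + pos_part (y - e) ^ 5) / (20 * e ^ 2)
        - pos_part y ^ 3) <= 2 * e ^ 2.
Proof.
intros He Hy. assert (He2 : 0 < e ^ 2) by (apply pow_lt; lra).
destruct (Rle_dec e y) as [H1|H1].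
- rewrite !pos_part_right by lra.
  replace (_ - _) with (y * e ^ 2 / 2) by (field; lra).
  rewrite Rabs_pos_eq by nra. nra.
- rewrite (pos_part_left (y - e)) by lra.
  assert (He3 : 0 < e ^ 3 <= e ^ 2) by (split; [apply pow_lt; lra|nra]).
  assert (Hq : forall z, 0 <= z <= 2 * e -> 0 <= z ^ 5 / (20 * e ^ 2) <= 8/5 * e ^ 3).
  { intros z Hz. assert (0 <= z ^ 5 <= (2 * e) ^ 5) by (split; [apply pow_le; lra|apply pow_incr; lra]).
    split; [apply Rdiv_le_0_compat; lra|].
    apply Rmult_le_reg_r with (20 * e ^ 2); [lra|].
    replace (z ^ 5 / (20 * e ^ 2) * (20 * e ^ 2)) with (z ^ 5) by (field; lra). nra. }
  destruct (Rle_dec 0 y) as [H2|H2].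
  + rewrite !pos_part_right by lra.
    pose proof (Hq (y + e) ltac:(lra)).
    assert (0 <= y ^ 5 <= y ^ 3 * e ^ 2).
    { split; [apply pow_le; lra|]. replace (y ^ 5) with (y ^ 3 * y ^ 2) by ring.
      apply Rmult_le_compat_l; [apply pow_le; lra|apply pow_incr; lra]. }
    assert (0 <= y ^ 3 <= e ^ 3) by (split; [apply pow_le; lra|apply pow_incr; lra]).
    assert (0 <= 2 * y ^ 5 / (20 * e ^ 2) <= y ^ 3 / 10).
    { split; [apply Rdiv_le_0_compat; lra|].
      apply Rmult_le_reg_r with (20 * e ^ 2); [lra|].
      replace (2 * y ^ 5 / (20 * e ^ 2) * (20 * e ^ 2)) with (2 * y ^ 5) by (field; lra). lra. }
    replace (_ - _) with ((y + e) ^ 5 / (20 * e ^ 2) - 2 * y ^ 5 / (20 * e ^ 2) - y ^ 3) by (field; lra).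
    apply Rabs_le; lra.
  + rewrite (pos_part_left y) by lra.
    assert (Hp : 0 <= pos_part (y + e) <= 2 * e).
    { split; [apply pos_part_ge0|]. unfold pos_part; apply Rmax_lub; lra. }
    pose proof (Hq _ Hp).
    replace (_ - _) with (pos_part (y + e) ^ 5 / (20 * e ^ 2)) by (field; lra).
    apply Rabs_le; lra.
Qed.

Lemma remainder_of_deriv_nonneg (Q : (R -> R) -> R) (c : R) (f f1 f2 f3 g : R -> R) :
  has_error_constant 4 Q c -> c < 0 -> C4 f f1 f2 f3 g -> (forall x, 0 <= g x) ->
  remainder Q f <= 0.
Proof.
intros Hc Hneg Hf Hg. destruct (Hc f g (C_on_of_C4 _ _ _ _ _ Hf)) as (xi & _ & ->).
specialize (Hg xi). nra.
Qed.

(* The Peano kernel is nonpositive: [pos_part (x - t) ^ 3] is a uniform limit of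
   C^4 functions with nonnegative fourth derivative. *)
Lemma remainder_truncated_cube (N : nat) (Q : (R -> R) -> R) (c t : R) :
  is_quadrature N Q -> has_error_constant 4 Q c -> c < 0 -> 0 <= t ->
  remainder Q (fun x => pos_part (x - t) ^ 3) <= 0.
Proof.
intros HQ Hc Hneg Ht.
destruct (remainder_small N Q HQ) as (C & HC & Hsmall).
assert (Hcont : forall k s x, continuous (fun x => pos_part (x - s) ^ S (S k)) x).
{ intros k s. apply continuous_of_derive with (1 := fun x => is_derive_pos_pow_shift k s x). }
assert (Hb : forall e, 0 < e <= 1 -> remainder Q (fun x => pos_part (x - t) ^ 3) <= C * (2 * e ^ 2)).
{ intros e He. assert (He2 : 0 < e ^ 2) by (apply pow_lt; lra).
  (* A scaled second difference of the truncated fifth power. Its fourth derivative is [6 / e^2]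
     times a second difference of the convex function [pos_part], hence nonnegative. *)
  set (U := fun x => 1 * (/ (20 * e ^ 2) * pos_part (x - (t - e)) ^ 5
      + - (2 / (20 * e ^ 2)) * pos_part (x - t) ^ 5) + / (20 * e ^ 2) * pos_part (x - (t + e)) ^ 5).
  pose proof (C4_lin 1 (/ (20 * e ^ 2)) _ _ _ _ _ _ _ _ _ _
    (C4_lin (/ (20 * e ^ 2)) (- (2 / (20 * e ^ 2))) _ _ _ _ _ _ _ _ _ _
     (C4_pos_pow5 (t - e)) (C4_pos_pow5 t)) (C4_pos_pow5 (t + e))) as HU.
  assert (HU0 : remainder Q U <= 0).
  { apply (remainder_of_deriv_nonneg _ _ _ _ _ _ _ Hc Hneg HU). intros x.
    replace (1 * _ + _) with (6 / e ^ 2 *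
      (pos_part (x - (t - e)) - 2 * pos_part (x - t) + pos_part (x - (t + e)))) by (field; lra).
    apply Rmult_le_pos; [apply Rdiv_le_0_compat; lra|].
    unfold pos_part, Rmax; repeat destruct Rle_dec; lra. }
  assert (HUc : forall x, continuous U x) by (apply continuous_of_derive with (1 := proj1 HU)).
  pose proof (remainder_lin N Q 1 (-1) (fun x => pos_part (x - t) ^ 3) U HQ (Hcont 1%nat t) HUc) as HL.
  assert (Hd : Rabs (remainder Q (fun x => 1 * pos_part (x - t) ^ 3 + -1 * U x)) <= C * (2 * e ^ 2)).
  { apply Hsmall.
    - intros x. apply (continuous_plus (fun x => 1 * pos_part (x - t) ^ 3) (fun x => -1 * U x)).
      + apply (continuous_mult (fun _ => 1) (fun x => pos_part (x - t) ^ 3));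
         [apply continuous_const|apply (Hcont 1%nat)].
      + apply (continuous_mult (fun _ => -1) U); [apply continuous_const|apply HUc].
    - intros x Hx.
      pose proof (second_difference_pow5 (x - t) e He ltac:(lra)) as H.
      rewrite <- Rabs_Ropp in H.
      replace (1 * pos_part (x - t) ^ 3 + -1 * U x) with
       (- ((pos_part (x - t + e) ^ 5 - 2 * pos_part (x - t) ^ 5 + pos_part (x - t - e) ^ 5)
          / (20 * e ^ 2) - pos_part (x - t) ^ 3)); [exact H|].
      unfold U. replace (x - (t - e)) with (x - t + e) by ring.
      replace (x - (t + e)) with (x - t - e) by ring. field; lra. }
  rewrite HL in Hd. apply Rabs_le_between in Hd. lra. }
apply Rnot_lt_le; intros Hlt.
set (r := remainder Q (fun x => pos_part (x - t) ^ 3)) in *.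
(* With this [e] the error [2 C e^2] is at most [r / 2]; using [C + 1] avoids a division by zero. *)
set (e := Rmin 1 (r / (4 * (C + 1)))).
assert (He0 : 0 < r / (4 * (C + 1))) by (apply Rdiv_lt_0_compat; lra).
assert (He : 0 < e <= 1) by (split; [apply Rmin_glb_lt; lra|apply Rmin_l]).
specialize (Hb e He).
assert (e ^ 2 <= e) by nra.
assert (e <= r / (4 * (C + 1))) by apply Rmin_r.
assert ((C + 1) * (2 * e ^ 2) <= r / 2).
{ replace (r / 2) with ((C + 1) * (2 * (r / (4 * (C + 1))))) by (field; lra).
  apply Rmult_le_compat_l; lra. }
nra.
Qed.

(** * Gluing arches *)

(* The kink position and mass for which the arch has a double zero at [h] with
   second derivative [- B / 12]. *)
Definition knot (A B h : R) : R := h * (h ^ 2 + B) / (2 * h ^ 2 + A + B).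
Definition mass (A B h : R) : R :=
  (2 * h ^ 2 + A + B) ^ 3 / (12 * ((h ^ 2 + A) * (h ^ 2 + B)) * h).

Definition arch (A B h s : R) : R :=
  - (A / 12) * s ^ 2 / 2 + slope A B h / 12 * s ^ 3 / 6 + s ^ 4 / 24
  - mass A B h * pos_part (s - knot A B h) ^ 3 / 6.

Lemma knot_bounds (A B h : R) : 0 < h -> 0 <= A -> 0 <= B -> 0 < knot A B h < h.
Proof.
intros Hh HA HB. assert (Hh2 : 0 < h ^ 2) by (apply pow_lt; lra). unfold knot. split.
- apply Rdiv_lt_0_compat; nra.
- apply Rmult_lt_reg_r with (2 * h ^ 2 + A + B); [lra|].
  replace (h * (h ^ 2 + B) / (2 * h ^ 2 + A + B) * (2 * h ^ 2 + A + B)) with (h * (h ^ 2 + B))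
   by (field; lra). nra.
Qed.

Lemma mass_pos (A B h : R) : 0 < h -> 0 <= A -> 0 <= B -> 0 < mass A B h.
Proof.
intros Hh HA HB. assert (Hh2 : 0 < h ^ 2) by (apply pow_lt; lra). unfold mass.
apply Rdiv_lt_0_compat; [apply pow_lt; lra|].
apply Rmult_lt_0_compat; [|lra]. assert (0 < (h ^ 2 + A) * (h ^ 2 + B)); [|lra].
apply Rmult_lt_0_compat; lra.
Qed.

(* To the right of its kink an arch is the Taylor polynomial at its right end,
   where it has a double zero. *)
Lemma arch_right (A B h s : R) : 0 < h -> 0 <= A -> 0 <= B -> knot A B h <= s ->
  arch A B h s = - (B / 12) * (s - h) ^ 2 / 2 - slope B A h / 12 * (s - h) ^ 3 / 6
    + (s - h) ^ 4 / 24.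
Proof.
intros Hh HA HB Hs. assert (Hh2 : 0 < h ^ 2) by (apply pow_lt; lra).
unfold arch. rewrite pos_part_right by lra. unfold knot, mass, slope.
field. repeat split; nra.
Qed.

Lemma arch_left (A B h : R) : 0 < h -> 0 <= A -> 0 <= B -> arch A B h 0 = 0.
Proof.
intros Hh HA HB. pose proof (knot_bounds A B h Hh HA HB).
unfold arch. rewrite pos_part_left by lra. field.
Qed.

Lemma is_RInt_arch (A B h z : R) : 0 < h -> 0 <= A -> 0 <= B ->
  is_RInt (fun x => arch A B h (x - z)) z (z + h) (- (gain A B h / 5760)).
Proof.
intros Hh HA HB. pose proof (knot_bounds A B h Hh HA HB) as Hk.
assert (Hh2 : 0 < h ^ 2) by (apply pow_lt; lra).
set (P := fun s => - (A / 12) * s ^ 3 / 6 + slope A B h / 12 * s ^ 4 / 24 + s ^ 5 / 120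
   - mass A B h / 24 * pos_part (s - knot A B h) ^ 4).
assert (HP : forall s, is_derive P s (arch A B h s)).
{ intros s. unfold P, arch.
  replace (_ - mass A B h * _ / 6) with
   ((- (A / 12) * s ^ 2 / 2 + slope A B h / 12 * s ^ 3 / 6 + s ^ 4 / 24)
     - mass A B h / 24 * (INR 4 * pos_part (s - knot A B h) ^ 3)) by (simpl; field).
  apply (is_derive_minus (fun s => - (A / 12) * s ^ 3 / 6 + slope A B h / 12 * s ^ 4 / 24 + s ^ 5 / 120)
    (fun s => mass A B h / 24 * pos_part (s - knot A B h) ^ 4)).
  - auto_derive; auto; field.
  - apply is_derive_scal. apply (is_derive_pos_pow_shift 2). }
replace (- (gain A B h / 5760)) with (minus (P (z + h - z)) (P (z - z))).
- apply (is_RInt_derive (V := R_CompleteNormedModule) (fun x => P (x - z))).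
  + intros x _. apply is_derive_shift, HP.
  + intros x _. unfold arch.
    apply (continuous_minus (fun x => - (A / 12) * (x - z) ^ 2 / 2 + slope A B h / 12 * (x - z) ^ 3 / 6
       + (x - z) ^ 4 / 24) (fun x => mass A B h * pos_part (x - z - knot A B h) ^ 3 / 6)).
    * apply (ex_derive_continuous (V := R_NormedModule)). auto_derive; auto.
    * assert (E : forall y : R, mass A B h / 6 * pos_part (y - (z + knot A B h)) ^ 3
        = mass A B h * pos_part (y - z - knot A B h) ^ 3 / 6).
      { intros y. replace (y - (z + knot A B h)) with (y - z - knot A B h) by ring. field. }
      apply (continuous_ext _ _ _ E).
      apply (continuous_mult (fun _ => mass A B h / 6)); [apply continuous_const|].
      apply continuous_of_derive with (1 := fun x => is_derive_pos_pow_shift 1 _ x).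
- unfold minus, plus, opp; simpl. unfold P.
  rewrite (pos_part_right (z + h - z - _)), (pos_part_left (z - z - _)) by lra.
  unfold gain, slope, mass, knot. field. repeat split; nra.
Qed.

Definition gaps (z : nat -> R) (i : nat) : R := z (S i) - z i.

Lemma gaps_pos (z : nat -> R) : (forall i, z i < z (S i)) -> forall i, 0 < gaps z i.
Proof. intros Hz i; unfold gaps; specialize (Hz i); lra. Qed.

Lemma increasing_le (z : nat -> R) : (forall i, z i < z (S i)) ->
  forall n p, (n <= p)%nat -> z n <= z p.
Proof. intros Hz n p Hnp; induction Hnp as [|m _ IH]; [lra|specialize (Hz m); lra]. Qed.

Definition unit_arch (z A : nat -> R) (i : nat) (x : R) : R := arch (A i) (A (S i)) (gaps z i) (x - z i).

(** Truncated powers replace a definition by cases. Neighbouring arches share value, first and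
    second derivative and the fourth derivative 1 at their common node, so only the jump of the
    third derivative and the next point mass are added. The remainder can then be estimated term by
    term. *)
Fixpoint comb (z A : nat -> R) (m : nat) : R -> R :=
  match m with
  | O => unit_arch z A O
  | S k => fun x => comb z A k x + kink (gaps z) A (A (S k)) k / 12 * (pos_part (x - z (S k)) ^ 3 / 6)
      - mass (A (S k)) (A (S (S k))) (gaps z (S k))
        * (pos_part (x - z (S k) - knot (A (S k)) (A (S (S k))) (gaps z (S k))) ^ 3 / 6)
  end.

Lemma comb_left (z A : nat -> R)
  (Hz : forall i, z i < z (S i)) (HA : forall i, 0 <= A i) (k : nat) (x : R) :
  x <= z (S k) -> comb z A (S k) x = comb z A k x.
Proof.
intros Hx. pose proof (knot_bounds (A (S k)) (A (S (S k))) (gaps z (S k)) (gaps_pos z Hz _) (HA _) (HA _)).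
simpl comb. rewrite !pos_part_left by lra. field.
Qed.

Lemma comb_right (z A : nat -> R)
  (Hz : forall i, z i < z (S i)) (HA : forall i, 0 <= A i) (m : nat) (x : R) :
  z m <= x -> comb z A m x = unit_arch z A m x.
Proof.
revert x; induction m as [|k IH]; intros x Hx; [reflexivity|].
pose proof (knot_bounds (A k) (A (S k)) (gaps z k) (gaps_pos z Hz _) (HA _) (HA _)) as Hk.
simpl comb. pose proof (Hz k). rewrite IH by lra. unfold unit_arch.
rewrite (arch_right (A k)); auto using gaps_pos; [|unfold gaps in Hk at 3; lra].
replace (x - z k - gaps z k) with (x - z (S k)) by (unfold gaps; ring).
unfold arch. rewrite (pos_part_right (x - z (S k))) by lra. unfold kink. field.
Qed.

Lemma comb_eq (z A : nat -> R)
  (Hz : forall i, z i < z (S i)) (HA : forall i, 0 <= A i) (m i : nat) (x : R) :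
  (i <= m)%nat -> z i <= x <= z (S i) -> comb z A m x = unit_arch z A i x.
Proof.
induction m as [|k IH]; intros Hi Hx.
- replace i with O by lia. reflexivity.
- destruct (Nat.eq_dec i (S k)) as [->|Hne]; [apply (comb_right z A Hz HA); lra|].
  rewrite (comb_left z A Hz HA); [apply IH; [lia|exact Hx]|].
  pose proof (increasing_le z Hz (S i) (S k) ltac:(lia)). lra.
Qed.

Lemma comb_node (z A : nat -> R)
  (Hz : forall i, z i < z (S i)) (HA : forall i, 0 <= A i) (m i : nat) :
  (i <= S m)%nat -> comb z A m (z i) = 0.
Proof.
intros Hi. destruct i as [|i].
- rewrite (comb_eq z A Hz HA m 0) by (try lia; specialize (Hz O); lra).
  unfold unit_arch. rewrite Rminus_diag. apply arch_left; auto using gaps_pos.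
- rewrite (comb_eq z A Hz HA m i) by (try lia; specialize (Hz i); lra).
  unfold unit_arch. pose proof (knot_bounds (A i) (A (S i)) (gaps z i) (gaps_pos z Hz _) (HA _) (HA _)).
  rewrite arch_right; auto using gaps_pos; unfold gaps in *; [field|lra].
Qed.

Lemma is_RInt_comb (z A : nat -> R)
  (Hz : forall i, z i < z (S i)) (HA : forall i, 0 <= A i) (m : nat) :
  is_RInt (comb z A m) (z O) (z (S m)) (- sum_f_R0 (fun i => gain (A i) (A (S i)) (gaps z i) / 5760) m).
Proof.
assert (Harch : forall i, is_RInt (unit_arch z A i) (z i) (z (S i))
  (- (gain (A i) (A (S i)) (gaps z i) / 5760))).
{ intros i. replace (z (S i)) with (z i + gaps z i) at 1 by (unfold gaps; ring).
  apply is_RInt_arch; auto using gaps_pos. }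
induction m as [|k IH]; [apply Harch|].
rewrite tech5, Ropp_plus_distr.
apply (is_RInt_Chasles (V := R_NormedModule) _ _ (z (S k))).
- apply is_RInt_ext with (comb z A k); [|exact IH].
  rewrite Rmin_left, Rmax_right by (apply (increasing_le z Hz); lia).
  intros x Hx. symmetry; apply (comb_left z A Hz HA); lra.
- apply is_RInt_ext with (unit_arch z A (S k)); [|apply Harch].
  rewrite Rmin_left, Rmax_right by (apply (increasing_le z Hz); lia).
  intros x Hx. symmetry; apply (comb_right z A Hz HA); lra.
Qed.

(** The first arch without its mass is a quartic with fourth derivative 1, of remainder exactly [c].
    Every later term is a nonpositive multiple of a truncated cube, whose remainder is nonpositive,
    so the remainder never drops. *)
Lemma comb_remainder (z A : nat -> R)
  (Hz : forall i, z i < z (S i)) (HA : forall i, 0 <= A i)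
  (N : nat) (Q : (R -> R) -> R) (c : R) (m : nat) :
  is_quadrature N Q -> has_error_constant 4 Q c -> c < 0 -> 0 <= z O ->
  (forall k, (S k <= m)%nat -> kink (gaps z) A (A (S k)) k <= 0) ->
  (forall x, continuous (comb z A m) x) /\ c <= remainder Q (comb z A m).
Proof.
intros HQ Hc Hneg Hz0.
assert (Hcub : forall t x, continuous (fun x => pos_part (x - t) ^ 3) x)
  by (intros t; apply continuous_of_derive with (1 := fun x => is_derive_pos_pow_shift 1 t x)).
assert (Hzk : forall k, 0 <= z k)
  by (intros k; pose proof (increasing_le z Hz O k (Nat.le_0_l k)); lra).
assert (HK : forall t, 0 <= t -> remainder Q (fun x => pos_part (x - t) ^ 3) <= 0)
  by (intros t Ht; apply (remainder_truncated_cube N Q c); auto).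
assert (Hstep : forall (f : R -> R) u t, (forall x, continuous f x) -> 0 <= u -> 0 <= t ->
  (forall x, continuous (fun x => 1 * f x + - u * pos_part (x - t) ^ 3) x) /\
  remainder Q f <= remainder Q (fun x => 1 * f x + - u * pos_part (x - t) ^ 3)).
{ intros f u t Hf Hu Ht. split.
  - intros x. apply (continuous_plus (fun x => 1 * f x) (fun x => - u * pos_part (x - t) ^ 3)).
    + apply (continuous_mult (fun _ => 1) f); [apply continuous_const|apply Hf].
    + apply (continuous_mult (fun _ => - u) (fun x => pos_part (x - t) ^ 3));
        [apply continuous_const|apply Hcub].
  - rewrite (remainder_lin N); auto. specialize (HK t Ht). nra. }
assert (Hrext : forall f g, (forall x, f x = g x) -> remainder Q f = remainder Q g).
{ intros f g Hfg. rewrite (functional_extensionality f g Hfg). reflexivity. }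
assert (Hcext : forall f g : R -> R, (forall x, f x = g x) -> (forall x, continuous f x) ->
  forall x, continuous g x) by (intros f g Hfg Hf x; apply continuous_ext with f; auto).
assert (Hpk : forall k, 0 < knot (A k) (A (S k)) (gaps z k) < gaps z k)
  by (intros; apply knot_bounds; auto using gaps_pos).
assert (Hmp : forall k, 0 < mass (A k) (A (S k)) (gaps z k)) by (intros; apply mass_pos; auto using gaps_pos).
induction m as [|k IH]; intros Hkink.
- set (p := fun x => - (A O / 12) * (x - z O) ^ 2 / 2
     + slope (A O) (A 1%nat) (gaps z O) / 12 * (x - z O) ^ 3 / 6
     + (x - z O) ^ 4 / 24).
  set (s := slope (A O) (A 1%nat) (gaps z O) / 12).
  pose proof (C4_quartic (- (A O / 12) * (z O) ^ 2 / 2 - s * (z O) ^ 3 / 6 + (z O) ^ 4 / 24)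
    (A O / 12 * z O + s * (z O) ^ 2 / 2 - (z O) ^ 3 / 6)
    (- (A O / 12) - s * z O + (z O) ^ 2 / 2) (s - z O) 1) as H4.
  set (q := fun x => _) in H4 at 1.
  assert (Hpq : forall x, q x = p x) by (intros x; unfold p, q; fold s; field).
  destruct (Hc _ _ (C_on_of_C4 _ _ _ _ _ H4)) as (xi & _ & HR). rewrite Rmult_1_r in HR.
  pose proof (continuous_of_derive _ _ (proj1 H4)) as Hqc. fold q in HR, Hqc.
  destruct (Hstep q (mass (A O) (A 1%nat) (gaps z O) / 6) (z O + knot (A O) (A 1%nat) (gaps z O))) as [S1 S2].
  + exact Hqc.
  + specialize (Hmp O). lra.
  + specialize (Hpk O). lra.
  + assert (E : forall x, 1 * q x + - (mass (A O) (A 1%nat) (gaps z O) / 6) *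
       pos_part (x - (z O + knot (A O) (A 1%nat) (gaps z O))) ^ 3 = comb z A O x).
    { intros x. simpl. unfold unit_arch, arch. rewrite Hpq. unfold p.
      replace (x - (z O + knot (A O) (A 1%nat) (gaps z O)))
        with (x - z O - knot (A O) (A 1%nat) (gaps z O)) by ring.
      field. }
    split; [apply (Hcext _ _ E S1)|]. rewrite <- (Hrext _ _ E). lra.
- destruct IH as [IHc IHr]; [intros; apply Hkink; lia|].
  specialize (Hkink k (le_n _)).
  destruct (Hstep (comb z A k) (- kink (gaps z) A (A (S k)) k / 12 / 6) (z (S k))) as [S1 S2]; auto.
  { lra. }
  destruct (Hstep _ (mass (A (S k)) (A (S (S k))) (gaps z (S k)) / 6)
    (z (S k) + knot (A (S k)) (A (S (S k))) (gaps z (S k))) S1) as [S3 S4].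
  { specialize (Hmp (S k)). lra. }
  { specialize (Hpk (S k)). specialize (Hzk (S k)). lra. }
  match type of S3 with forall x, continuous ?f x =>
    assert (E : forall x, f x = comb z A (S k) x) end.
  { intros x. simpl comb.
    replace (x - (z (S k) + knot (A (S k)) (A (S (S k))) (gaps z (S k))))
     with (x - z (S k) - knot (A (S k)) (A (S (S k))) (gaps z (S k))) by ring.
    field. }
  split; [apply (Hcext _ _ E S3)|]. rewrite <- (Hrext _ _ E).
  exact (Rle_trans _ _ _ (Rle_trans _ _ _ IHr S2) S4).
Qed.

(** * The bound on error constants *)

(** The arches must fill [[0, 1]], so endpoints that are not nodes are added. At most [N + 2] points
    arise, hence [m + 1 <= N + 1] gaps. *)
Lemma nodes_with_endpoints (N : nat) (tau : nat -> R) : (1 <= N)%nat ->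
  (forall i, (1 <= i <= N)%nat -> 0 <= tau i <= 1) ->
  (forall i j, (1 <= i)%nat -> (i < j)%nat -> (j <= N)%nat -> tau i < tau j) ->
  exists (m : nat) (z : nat -> R), (m <= N)%nat /\ (forall i, z i < z (S i)) /\
    z O = 0 /\ z (S m) = 1 /\
    forall i, (1 <= i <= N)%nat -> exists j, (j <= S m)%nat /\ tau i = z j.
Proof.
intros HN Hr Hlt.
(* The left end first: [s] lists [n] points starting with 0. *)
assert (H1 : exists (n : nat) (s : nat -> R), (1 <= n <= S N)%nat /\
  (forall i, (S i < n)%nat -> s i < s (S i)) /\ s O = 0 /\
  (forall i, (i < n)%nat -> 0 <= s i <= 1) /\
  forall i, (1 <= i <= N)%nat -> exists j, (j < n)%nat /\ tau i = s j).
{ destruct (Req_dec (tau 1%nat) 0) as [E|E].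
  - exists N, (fun i => tau (S i)). repeat split; try lia.
    + intros i Hi. apply Hlt; lia.
    + exact E.
    + apply Hr; lia.
    + apply Hr; lia.
    + intros i Hi. exists (pred i). split; [lia|]. f_equal; lia.
  - exists (S N), (fun i => match i with O => 0 | S k => tau (S k) end).
    repeat split; try lia.
    + intros [|i] Hi; [|apply Hlt; lia]. pose proof (Hr 1%nat ltac:(lia)). lra.
    + destruct i; [lra|apply Hr; lia].
    + destruct i; [lra|apply Hr; lia].
    + intros i Hi. exists i. split; [lia|]. destruct i; [lia|reflexivity]. }
destruct H1 as (n & s & Hn & Hs & Hs0 & Hs1 & Hcov).
(* Then the right end: 1 is either the last listed point or still to be appended, at index [m + 1]
   in both cases. *)
assert (H2 : exists m, (n <= S (S m))%nat /\ (m <= N)%nat /\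
  ((n = S (S m) /\ s (S m) = 1) \/ (n = S m /\ s m < 1))).
{ destruct n as [|n]; [lia|].
  destruct (Req_dec (s n) 1) as [E|E].
  - destruct n as [|m]; [lra|]. exists m. repeat split; try lia. left; auto.
  - exists n. repeat split; try lia. right; split; [reflexivity|].
    pose proof (Hs1 n ltac:(lia)). lra. }
destruct H2 as (m & Hnm & HmN & Hcase).
(* Past index [m] the sequence goes on 1, 2, 3, ..., so it is increasing at all indices, as the
   gluing lemmas demand. *)
exists m, (fun i => if le_lt_dec i m then s i else INR (i - m)).
split; [exact HmN|]. split; [|split; [|split]].
- intros i. destruct (le_lt_dec i m), (le_lt_dec (S i) m); try lia.
  + apply Hs; lia.
  + replace i with m by lia. replace (S m - m)%nat with 1%nat by lia. simpl.
    destruct Hcase as [[-> E]|[_ E]]; [|exact E]. rewrite <- E. apply Hs; lia.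
  + apply lt_INR; lia.
- simpl. exact Hs0.
- destruct (le_lt_dec (S m) m); [lia|]. replace (S m - m)%nat with 1%nat by lia. reflexivity.
- intros i Hi. destruct (Hcov i Hi) as (j & Hj & E). exists j. split; [lia|].
  destruct (le_lt_dec j m); [exact E|].
  destruct Hcase as [[-> E1]|[-> _]]; [|lia].
  replace j with (S m) in * by lia. rewrite E, E1.
  replace (S m - m)%nat with 1%nat by lia. reflexivity.
Qed.

(** Values scale as squared lengths and third derivatives as lengths, so admissibility does not
    depend on the unit of length. *)
Lemma slope_scale (A B h s : R) : 0 < h -> 0 < s -> 0 <= B ->
  slope (A / s ^ 2) (B / s ^ 2) (h / s) = slope A B h / s.
Proof.
intros Hh Hs HB. assert (Hh2 : 0 < h ^ 2) by (apply pow_lt; lra).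
unfold slope. field. repeat split; lra.
Qed.

Lemma gain_scale (A B h s : R) : 0 < h -> 0 < s -> 0 <= A -> 0 <= B ->
  gain (A / s ^ 2) (B / s ^ 2) (h / s) = gain A B h / s ^ 5.
Proof.
intros Hh Hs HA HB. assert (Hh2 : 0 < h ^ 2) by (apply pow_lt; lra).
unfold gain. field. repeat split; lra.
Qed.

(** Lengths are multiplied by the number [s] of gaps, so that the mean gap is 1, where the tangent
    in [gap_inequality] is taken. The total gain is then at least [35 s - 28 s = 7 s], and scaling
    back divides it by [s^5]. The glued function vanishes at all nodes, so its remainder is its
    integral. *)
Lemma error_constant_le (N : nat) (Q : (R -> R) -> R) (c : R) : (1 <= N)%nat ->
  is_quadrature N Q -> has_error_constant 4 Q c -> c < 0 ->
  c <= - (7 / (5760 * INR (S N) ^ 4)).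
Proof.
intros HN HQ Hc Hneg.
pose proof HQ as (tau & w & Hr & Hlt & HQf).
destruct (nodes_with_endpoints N tau HN Hr Hlt) as (m & z & HmN & Hz & Hz0 & Hz1 & Hcov).
set (s := INR (S m)).
assert (Hs : 0 < s) by (apply lt_0_INR; lia).
assert (Hg : forall i, 0 < s * gaps z i)
  by (intros; apply Rmult_lt_0_compat; [|apply gaps_pos]; auto).
destruct (total_gain_ge (fun i => s * gaps z i) m Hg) as (a & [Ha Hk] & Hsum).
assert (Hs2 : 0 < s ^ 2) by (apply pow_lt; lra).
set (A := fun i => a i / s ^ 2).
assert (HA : forall i, 0 <= A i) by (intros i; apply Rdiv_le_0_compat; [apply Ha|lra]).
assert (Hkink : forall k, (S k <= m)%nat -> kink (gaps z) A (A (S k)) k <= 0).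
{ intros k Hkm. specialize (Hk k ltac:(lia)). unfold kink in *.
  replace (gaps z k) with (s * gaps z k / s) by (field; lra).
  replace (gaps z (S k)) with (s * gaps z (S k) / s) by (field; lra).
  unfold A. rewrite !slope_scale by (auto; apply Ha).
  unfold Rdiv. rewrite <- Rmult_plus_distr_r.
  assert (0 < / s) by (apply Rinv_0_lt_compat; lra). nra. }
destruct (comb_remainder z A Hz HA N Q c m HQ Hc Hneg ltac:(lra) Hkink) as [_ HR].
assert (HQ0 : Q (comb z A m) = 0).
{ rewrite HQf. rewrite (sum_n_m_ext_loc _ (fun _ => 0)).
  - rewrite sum_n_m_const. apply Rmult_0_r.
  - intros i Hi. destruct (Hcov i Hi) as (j & Hj & ->).
    rewrite comb_node by auto. apply Rmult_0_r. }
assert (HI : RInt (comb z A m) 0 1 =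
  - sum_f_R0 (fun i => gain (a i) (a (S i)) (s * gaps z i)) m / (5760 * s ^ 5)).
{ apply is_RInt_unique. rewrite <- Hz0, <- Hz1 at 1.
  replace (- _ / _) with (- sum_f_R0 (fun i => gain (A i) (A (S i)) (gaps z i) / 5760) m).
  - apply is_RInt_comb; auto.
  - unfold Rdiv at 2. rewrite <- Ropp_mult_distr_l. f_equal.
    rewrite Rmult_comm, scal_sum. apply sum_eq. intros i _.
    replace (gaps z i) with (s * gaps z i / s) at 1 by (field; lra).
    unfold A. rewrite gain_scale by (auto; apply Ha). field. lra. }
assert (Htel : sum_f_R0 (fun i => s * gaps z i) m = s).
{ assert (E : forall k, sum_f_R0 (fun i => s * gaps z i) k = s * (z (S k) - z O)).
  { induction k as [|k IH]; [simpl; unfold gaps; ring|]. rewrite tech5, IH. unfold gaps; ring. }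
  rewrite E, Hz0, Hz1; ring. }
unfold remainder in HR. rewrite HQ0, HI, Rminus_0_r in HR. rewrite Htel in Hsum. fold s in Hsum.
eapply Rle_trans; [exact HR|].
assert (Hs4 : 0 < s ^ 4) by (apply pow_lt; lra).
assert (Hs5 : 0 < s ^ 5) by (apply pow_lt; lra).
apply Rle_trans with (- (7 / (5760 * s ^ 4))).
- replace (- (7 / (5760 * s ^ 4))) with (- (7 * s) / (5760 * s ^ 5)) by (field; lra).
  apply Rmult_le_compat_r; [left; apply Rinv_0_lt_compat; lra|]. lra.
(* There are at most [N + 1] gaps, and more gaps only weaken the bound. *)
- apply Ropp_le_contravar. apply Rmult_le_compat_l; [lra|].
  apply Rinv_le_contravar; [lra|]. apply Rmult_le_compat_l; [lra|].
  apply pow_incr. split; [lra|]. apply le_INR; lia.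
Qed.

(** * Smooth functions on [0,1] and the Peano kernel *)

(** The nearest-point retraction onto [[0, 1]]; composition with it extends continuous functions to
    the line. *)
Definition clip (x : R) : R := Rmax 0 (Rmin x 1).

Lemma clip_I01 (x : R) : I01 (clip x).
Proof. unfold I01, clip, Rmax, Rmin; repeat destruct Rle_dec; lra. Qed.

Lemma clip_id (x : R) : I01 x -> clip x = x.
Proof. unfold I01, clip, Rmax, Rmin; intros; repeat destruct Rle_dec; lra. Qed.

Lemma clip_lipschitz (x y : R) : Rabs (clip y - clip x) <= Rabs (y - x).
Proof.
unfold clip, Rmax, Rmin; repeat destruct Rle_dec; unfold Rabs; repeat destruct Rcase_abs; lra.
Qed.

Lemma continuous_clip (g : R -> R) : (forall x, I01 x -> continue_in g I01 x) ->
  forall x, continuous (fun y => g (clip y)) x.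
Proof.
intros Hg x. apply continuity_pt_filterlim. intros eps Heps.
destruct (Hg (clip x) (clip_I01 x) eps Heps) as (d & Hd & Hc).
exists d. split; [exact Hd|]. intros y [_ Hy]. simpl in *. unfold Rdist in *.
destruct (Req_dec (clip y) (clip x)) as [E|E].
- rewrite E, Rminus_diag, Rabs_R0. exact Heps.
- apply Hc. split; [split; [apply clip_I01|intros E'; apply E; symmetry; exact E']|].
  eapply Rle_lt_trans; [apply clip_lipschitz|exact Hy].
Qed.

(** The function [f 0 + RInt h0 0 x] is differentiable on the whole line. It agrees with [f] on the
    interval because the values at 0 and the derivatives inside coincide. *)
Lemma extend_primitive (f h h0 : R -> R) :
  (forall x, I01 x -> D_in f h I01 x) -> (forall x, continuous h0 x) ->
  (forall x, I01 x -> h x = h0 x) ->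
  exists f0, (forall x, is_derive f0 x (h0 x)) /\ forall x, I01 x -> f x = f0 x.
Proof.
intros HD Hc Hh.
set (f0 := fun x => f 0 + RInt h0 0 x).
assert (Hf0 : forall x, is_derive f0 x (h0 x)).
{ intros x. unfold f0. replace (h0 x) with (0 + h0 x) by ring.
  apply (is_derive_plus (fun _ => f 0) (fun x => RInt h0 0 x)); [apply (is_derive_const (f 0))|].
  apply (is_derive_RInt (V := R_NormedModule) h0 _ 0); [|apply Hc].
  exists (mkposreal 1 Rlt_0_1). intros y _.
  apply (RInt_correct (V := R_CompleteNormedModule)), ex_RInt_cont, Hc. }
exists f0. split; [exact Hf0|]. intros x Hx.
set (d := fun y => f (clip y) - f0 y).
assert (Hdc : forall y, continuous d y).
{ intros y. apply (continuous_minus (fun y => f (clip y)) f0).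
  - apply continuous_clip. intros t Ht. apply cont_deriv with h, HD, Ht.
  - apply continuous_of_derive with (1 := Hf0). }
assert (Hdd : forall y, 0 < y < 1 -> is_derive d y 0).
{ intros y Hy. replace 0 with (h y - h0 y) by (rewrite Hh; [ring|unfold I01; lra]).
  apply (is_derive_minus (fun y => f (clip y)) f0); [|apply Hf0].
  apply is_derive_Reals. intros eps Heps.
  destruct (HD y ltac:(unfold I01; lra) eps Heps) as (a & Ha & Hlim).
  assert (Hm : 0 < Rmin a (Rmin y (1 - y))) by (repeat apply Rmin_glb_lt; lra).
  exists (mkposreal _ Hm). intros k Hk Hlt. simpl in Hlt.
  assert (H1 : Rabs k < a) by (eapply Rlt_le_trans; [exact Hlt|apply Rmin_l]).
  assert (H2 : Rabs k < y /\ Rabs k < 1 - y).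
  { split; (eapply Rlt_le_trans; [exact Hlt|]); (eapply Rle_trans; [apply Rmin_r|]);
     [apply Rmin_l|apply Rmin_r]. }
  destruct H2 as [H2 H3]. apply Rabs_def2 in H2. apply Rabs_def2 in H3.
  rewrite !clip_id by (unfold I01; lra).
  specialize (Hlim (y + k)). simpl in Hlim. unfold Rdist in Hlim.
  replace (y + k - y) with k in Hlim by ring.
  apply Hlim. split; [split; [unfold I01; lra|lra]|exact H1]. }
destruct (MVT_gen d 0 x (fun _ => 0)) as (xi & _ & E).
- unfold I01 in Hx. rewrite Rmin_left, Rmax_right by lra. intros y Hy. apply Hdd; lra.
- intros y _. apply continuity_pt_filterlim, Hdc.
- rewrite Rmult_0_l in E. unfold d in E.
  rewrite !clip_id in E by (unfold I01 in *; lra).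
  unfold f0 at 2 in E. rewrite RInt_point in E. unfold zero in E; simpl in E. lra.
Qed.

(** The fourth derivative is extended by [clip] and then integrated four times, from the top
    derivative down. *)
Lemma C4_of_C_on (f g : R -> R) : C_on 4 f g ->
  exists f0 f1 f2 f3 g0, C4 f0 f1 f2 f3 g0 /\
    (forall x, I01 x -> f x = f0 x) /\ forall x, I01 x -> g x = g0 x.
Proof.
intros [(h1 & D1 & h2 & D2 & h3 & D3 & h4 & D4 & E) Hg].
set (g0 := fun y => g (clip y)).
assert (Hg0 : forall x, continuous g0 x) by (apply continuous_clip, Hg).
assert (E0 : forall x, I01 x -> g x = g0 x) by (intros x Hx; unfold g0; rewrite clip_id; auto).
destruct (extend_primitive h3 h4 g0 D4 Hg0) as (f3 & F3 & E3).
{ intros x Hx. rewrite E; auto. }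
destruct (extend_primitive h2 h3 f3 D3 (continuous_of_derive _ _ F3) E3) as (f2 & F2 & E2).
destruct (extend_primitive h1 h2 f2 D2 (continuous_of_derive _ _ F2) E2) as (f1 & F1 & E1).
destruct (extend_primitive f h1 f1 D1 (continuous_of_derive _ _ F1) E1) as (f0 & F0 & Ef).
exists f0, f1, f2, f3, g0. split; [|split; auto]. exact (conj F0 (conj F1 (conj F2 (conj F3 Hg0)))).
Qed.

Lemma C4_shift (t : R) (f f1 f2 f3 g : R -> R) : C4 f f1 f2 f3 g ->
  C4 (fun x => f (x - t)) (fun x => f1 (x - t)) (fun x => f2 (x - t)) (fun x => f3 (x - t))
     (fun x => g (x - t)).
Proof.
intros (F0 & F1 & F2 & F3 & Fg). split; [|split; [|split; [|split]]]; intros x;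
 try (apply is_derive_shift; auto).
apply (continuous_comp (fun x => x - t) g); [|apply Fg].
apply (continuous_minus (fun y => y) (fun _ => t)); [apply continuous_id|apply continuous_const].
Qed.

Lemma is_derive_reflect (f : R -> R) (x l : R) :
  is_derive f (1 - x) l -> is_derive (fun y => f (1 - y)) x (- l).
Proof.
intros H. replace (- l) with (scal (-1) l) by (unfold scal; simpl; unfold mult; simpl; ring).
apply (is_derive_comp f (fun y => 1 - y)); [exact H|].
auto_derive; auto; ring.
Qed.

Lemma C4_reflect (f f1 f2 f3 g : R -> R) : C4 f f1 f2 f3 g ->
  C4 (fun x => f (1 - x)) (fun x => - f1 (1 - x)) (fun x => f2 (1 - x)) (fun x => - f3 (1 - x))
     (fun x => g (1 - x)).
Proof.
intros (F0 & F1 & F2 & F3 & Fg). split; [|split; [|split; [|split]]]; intros x.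
- apply is_derive_reflect; auto.
- rewrite <- (Ropp_involutive (f2 (1 - x))).
  apply (is_derive_opp (fun x => f1 (1 - x))), is_derive_reflect; auto.
- apply is_derive_reflect; auto.
- rewrite <- (Ropp_involutive (g (1 - x))).
  apply (is_derive_opp (fun x => f3 (1 - x))), is_derive_reflect; auto.
- apply (continuous_comp (fun x => 1 - x) g); [|apply Fg].
  apply (continuous_minus (fun _ => 1) (fun y => y)); [apply continuous_const|apply continuous_id].
Qed.

Definition bracket (p p1 p2 p3 f f1 f2 f3 : R -> R) (x : R) : R :=
  p3 x * f x - p2 x * f1 x + p1 x * f2 x - p x * f3 x.

(* Repeated integration by parts against a quartic [p] with p'''' = 1. *)
Lemma RInt_le_bracket (p p1 p2 p3 f f1 f2 f3 g : R -> R) (u v : R) :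
  C4 p p1 p2 p3 (fun _ => 1) -> C4 f f1 f2 f3 g -> u <= v ->
  (forall x, u <= x <= v -> p x <= 0) -> (forall x, u <= x <= v -> 0 <= g x) ->
  RInt f u v <= bracket p p1 p2 p3 f f1 f2 f3 v - bracket p p1 p2 p3 f f1 f2 f3 u.
Proof.
intros HP HF Huv Hp Hg.
pose proof HP as (P0 & P1 & P2 & P3 & _). pose proof HF as (F0 & F1 & F2 & F3 & Fg).
(* The derivative telescopes to [f - p g], which is at least [f] where [p <= 0 <= g]. *)
assert (Hd : forall x, is_derive (bracket p p1 p2 p3 f f1 f2 f3) x (f x - p x * g x)).
{ intros x. unfold bracket.
  replace (f x - p x * g x) with
   ((1 * f x + p3 x * f1 x) - (p3 x * f1 x + p2 x * f2 x) + (p2 x * f2 x + p1 x * f3 x)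
    - (p1 x * f3 x + p x * g x)) by ring.
  assert (M : forall a a' b b' : R -> R, is_derive a x (a' x) -> is_derive b x (b' x) ->
    is_derive (fun x => a x * b x) x (a' x * b x + a x * b' x)).
  { intros a a' b b' Ha Hb. apply (is_derive_mult a b); auto. intros; apply Rmult_comm. }
  apply (is_derive_minus (fun x => p3 x * f x - p2 x * f1 x + p1 x * f2 x) (fun x => p x * f3 x));
    [|apply (M p p1 f3 g); auto].
  apply (is_derive_plus (fun x => p3 x * f x - p2 x * f1 x) (fun x => p1 x * f2 x));
    [|apply (M p1 p2 f2 f3); auto].
  apply (is_derive_minus (fun x => p3 x * f x) (fun x => p2 x * f1 x));
    [apply (M p3 (fun _ => 1) f f1); auto|apply (M p2 p3 f1 f2); auto]. }
assert (Hc : forall x, continuous (fun x => f x - p x * g x) x).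
{ intros x. apply (continuous_minus f (fun x => p x * g x)).
  - apply continuous_of_derive with (1 := F0).
  - apply (continuous_mult p g); [apply continuous_of_derive with (1 := P0)|apply Fg]. }
replace (_ - _) with (RInt (fun x => f x - p x * g x) u v).
- apply RInt_le; auto.
  + apply ex_RInt_cont, continuous_of_derive with (1 := F0).
  + apply ex_RInt_cont, Hc.
  + intros x Hx. specialize (Hp x ltac:(lra)). specialize (Hg x ltac:(lra)). nra.
- apply is_RInt_unique.
  apply (is_RInt_derive (V := R_CompleteNormedModule) (bracket p p1 p2 p3 f f1 f2 f3)); auto.
Qed.

Lemma RInt_split (f : R -> R) (a b c : R) : (forall x, continuous f x) ->
  RInt f a c = RInt f a b + RInt f b c.
Proof.
intros Hf. symmetry. apply (RInt_Chasles (V := R_CompleteNormedModule)); apply ex_RInt_cont, Hf.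
Qed.

(** The kernel is [s^2 (s^2 - h^2 / 2) / 24] around the midpoint: nonpositive on the panel, with
    derivative zero and value [- h^4 / 384] at both ends. These boundary data repeat from panel to
    panel, so the derivative terms telescope. *)
Lemma middle_panel (f f1 f2 f3 g : R -> R) (u h : R) : C4 f f1 f2 f3 g -> 0 < h ->
  (forall x, u <= x <= u + h -> 0 <= g x) ->
  RInt f u (u + h) <= h / 2 * (f u + f (u + h)) - h ^ 2 / 12 * (f1 (u + h) - f1 u)
    + h ^ 4 / 384 * (f3 (u + h) - f3 u).
Proof.
intros HF Hh Hg.
pose proof (C4_shift (u + h / 2) _ _ _ _ _ (C4_quartic 0 0 (- h ^ 2 / 24) 0 1)) as HP.
eapply Rle_trans; [apply (RInt_le_bracket _ _ _ _ _ _ _ _ _ u (u + h) HP HF); [lra| |exact Hg]|].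
- intros x Hx. set (s := x - (u + h / 2)). cbv beta.
  assert (Hs : 0 <= (h / 2 - s) * (h / 2 + s)) by (apply Rmult_le_pos; unfold s; lra).
  assert (0 <= s ^ 2) by apply pow2_ge_0. assert (0 < h ^ 2) by (apply pow_lt; lra).
  replace (_ + _ + _ + _ + _) with (s ^ 2 * (s ^ 2 - h ^ 2 / 2) / 24) by field.
  nra.
- right. unfold bracket. field.
Qed.

(** The kernel starts with a triple zero at 0, and the end weights steer it on [[h, 3h/2]] into the
    quartic of a panel centred at [h]. Its boundary data at [3h/2] thus match [middle_panel]. *)
Lemma left_end (f f1 f2 f3 g : R -> R) (h : R) : C4 f f1 f2 f3 g -> 0 < h ->
  (forall x, 0 <= x <= 3 * h / 2 -> 0 <= g x) ->
  RInt f 0 (3 * h / 2) <=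
    h * (13 / 72 * f 0 + 1 / 2 * f (h / 2) + 4 / 9 * f (3 * h / 4) - 1 / 8 * f h
         + 1 / 2 * f (3 * h / 2))
    - h ^ 2 / 12 * f1 (3 * h / 2) + h ^ 4 / 384 * f3 (3 * h / 2).
Proof.
intros HF Hh Hg.
pose proof (continuous_of_derive _ _ (proj1 HF)) as Hc.
assert (Hh4 : 0 < h ^ 4) by (apply pow_lt; lra).
(* The kernel loses [w (s - t)^3 / 6] at each node [t] of weight [w]. *)
pose proof (C4_quartic 0 0 0 (- 13 * h / 72) 1) as P0.
pose proof (C4_quartic (h ^ 4 / 96) (- h ^ 3 / 16) (h ^ 2 / 4) (- 13 * h / 72 - h / 2) 1) as P1.
pose proof (C4_quartic (h ^ 4 / 96 + h ^ 4 / 32) (- h ^ 3 / 16 - h ^ 3 / 8) (h ^ 2 / 4 + h ^ 2 / 3)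
  (- 13 * h / 72 - h / 2 - 4 * h / 9) 1) as P2.
pose proof (C4_quartic (h ^ 4 / 96 + h ^ 4 / 32 - h ^ 4 / 48) (- h ^ 3 / 16 - h ^ 3 / 8 + h ^ 3 / 16)
  (h ^ 2 / 4 + h ^ 2 / 3 - h ^ 2 / 8) (- 13 * h / 72 - h / 2 - 4 * h / 9 + h / 8) 1) as P3.
rewrite (RInt_split f 0 (h / 2)), (RInt_split f (h / 2) (3 * h / 4)),
  (RInt_split f (3 * h / 4) h) by exact Hc.
pose proof (RInt_le_bracket _ _ _ _ _ _ _ _ _ 0 (h / 2) P0 HF) as B0.
pose proof (RInt_le_bracket _ _ _ _ _ _ _ _ _ (h / 2) (3 * h / 4) P1 HF) as B1.
pose proof (RInt_le_bracket _ _ _ _ _ _ _ _ _ (3 * h / 4) h P2 HF) as B2.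
pose proof (RInt_le_bracket _ _ _ _ _ _ _ _ _ h (3 * h / 2) P3 HF) as B3.
cbv beta in *.
(* Substituting [s = h y] turns the four sign conditions into polynomial inequalities in [y]
   alone. *)
assert (Hscale : forall s, exists y, s = h * y) by (intros s; exists (s / h); field; lra).
assert (Hdiv : forall a b s y : R, s = h * y -> h * a <= s <= h * b -> a <= y <= b).
{ intros a b s y -> [H1 H2]; split; apply Rmult_le_reg_l with h; lra. }
specialize (B0 ltac:(lra)). specialize (B1 ltac:(lra)).
specialize (B2 ltac:(lra)). specialize (B3 ltac:(lra)).
assert (G : forall a b, 0 <= a -> b <= 3 * h / 2 -> forall x, a <= x <= b -> 0 <= g x)
  by (intros; apply Hg; lra).
eapply Rle_trans.
- apply Rplus_le_compat; [|apply Rplus_le_compat; [|apply Rplus_le_compat]].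
  + apply B0; [|apply G; lra]. intros s Hs. destruct (Hscale s) as (y & Ey).
    pose proof (Hdiv 0 (1/2) s y Ey ltac:(lra)) as Hy. rewrite Ey.
    replace (_ + _) with (h ^ 4 * (y ^ 3 * (y / 24 - 13 / 432))) by field.
    assert (0 <= y ^ 3) by (apply pow_le; lra).
    assert (0 <= y ^ 3 * (13 / 432 - y / 24)) by (apply Rmult_le_pos; lra). nra.
  + apply B1; [|apply G; lra]. intros s Hs. destruct (Hscale s) as (y & Ey).
    pose proof (Hdiv (1/2) (3/4) s y Ey ltac:(lra)) as Hy. rewrite Ey.
    replace (_ + _) with (- (h ^ 4 * (13 / 432 * y ^ 3 + (y - 1 / 2) ^ 3 / 12 - y ^ 4 / 24))) by field.
    assert (0 <= 13 / 432 * y ^ 3 + (y - 1 / 2) ^ 3 / 12 - y ^ 4 / 24); [|nra].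
    set (t := y - 1 / 2). replace y with (1 / 2 + t) by (unfold t; ring).
    assert (Ht : 0 <= t <= 1 / 4) by (unfold t; lra). clearbody t.
    assert (0 <= t ^ 3) by (apply pow_le; lra).
    assert (0 <= t ^ 3 * (1 / 4 - t)) by (apply Rmult_le_pos; lra).
    assert (t ^ 2 <= 1 / 16) by nra.
    nra.
  + apply B2; [|apply G; lra]. intros s Hs. destruct (Hscale s) as (y & Ey).
    pose proof (Hdiv (3/4) 1 s y Ey ltac:(lra)) as Hy. rewrite Ey.
    replace (_ + _) with (- (h ^ 4 * ((1 - y) ^ 2 * (1 / 2 - (1 - y) / 2 - (1 - y) ^ 2) / 24))) by field.
    assert (0 <= (1 - y) ^ 2) by apply pow2_ge_0.
    assert (0 <= (1 - y) ^ 2 * (1 / 2 - (1 - y) / 2 - (1 - y) ^ 2)) by (apply Rmult_le_pos; nra). nra.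
  + apply B3; [|apply G; lra]. intros s Hs. destruct (Hscale s) as (y & Ey).
    pose proof (Hdiv 1 (3/2) s y Ey ltac:(lra)) as Hy. rewrite Ey.
    replace (_ + _) with (- (h ^ 4 * ((y - 1) ^ 2 * (1 / 2 - (y - 1) ^ 2) / 24))) by field.
    assert (0 <= (y - 1) ^ 2) by apply pow2_ge_0.
    assert (0 <= (y - 1) ^ 2 * (1 / 2 - (y - 1) ^ 2)) by (apply Rmult_le_pos; nra). nra.
- right. unfold bracket. field.
Qed.

Lemma middle_panels (f f1 f2 f3 g : R -> R) (u h : R) (j : nat) : C4 f f1 f2 f3 g -> 0 < h ->
  (forall x, u <= x <= u + INR j * h -> 0 <= g x) ->
  RInt f u (u + INR j * h) <=
    h * sum_f_R0 (fun i => f (u + INR i * h)) j - h / 2 * (f u + f (u + INR j * h))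
    - h ^ 2 / 12 * (f1 (u + INR j * h) - f1 u) + h ^ 4 / 384 * (f3 (u + INR j * h) - f3 u).
Proof.
intros HF Hh. pose proof (continuous_of_derive _ _ (proj1 HF)) as Hc.
induction j as [|j IH]; intros Hg.
- simpl sum_f_R0. simpl INR. rewrite Rmult_0_l, Rplus_0_r, RInt_point.
  unfold zero; simpl. lra.
- rewrite tech5. rewrite S_INR in *.
  replace (u + (INR j + 1) * h) with (u + INR j * h + h) in * by ring.
  assert (Hj : 0 <= INR j * h) by (apply Rmult_le_pos; [apply pos_INR|lra]).
  specialize (IH ltac:(intros; apply Hg; lra)).
  pose proof (middle_panel f f1 f2 f3 g (u + INR j * h) h HF Hh ltac:(intros; apply Hg; lra)).
  rewrite (RInt_split f u (u + INR j * h)) by exact Hc.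
  lra.
Qed.

(** The mirror image of [left_end]; odd derivatives change sign. *)
Lemma right_end (f f1 f2 f3 g : R -> R) (h : R) : C4 f f1 f2 f3 g -> 0 < h ->
  (forall x, 1 - 3 * h / 2 <= x <= 1 -> 0 <= g x) ->
  RInt f (1 - 3 * h / 2) 1 <=
    h * (13 / 72 * f 1 + 1 / 2 * f (1 - h / 2) + 4 / 9 * f (1 - 3 * h / 4) - 1 / 8 * f (1 - h)
         + 1 / 2 * f (1 - 3 * h / 2))
    + h ^ 2 / 12 * f1 (1 - 3 * h / 2) - h ^ 4 / 384 * f3 (1 - 3 * h / 2).
Proof.
intros HF Hh Hg.
pose proof (continuous_of_derive _ _ (proj1 HF)) as Hc.
pose proof (left_end _ _ _ _ _ h (C4_reflect _ _ _ _ _ HF) Hh ltac:(intros; apply Hg; lra)) as H.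
cbv beta in H. rewrite Rminus_0_r in H.
replace (RInt f (1 - 3 * h / 2) 1) with (RInt (fun y => f (1 - y)) 0 (3 * h / 2)); [lra|].
assert (E : RInt (fun y => -1 * f (-1 * y + 1)) 0 (3 * h / 2) = RInt f 1 (1 - 3 * h / 2)).
{ pose proof (RInt_comp_lin (V := R_CompleteNormedModule) f (-1) 1 0 (3 * h / 2)
    (ex_RInt_cont _ _ _ Hc)) as E.
  replace (-1 * 0 + 1) with 1 in E by ring.
  replace (-1 * (3 * h / 2) + 1) with (1 - 3 * h / 2) in E by ring. exact E. }
assert (E1 : RInt (fun y => -1 * f (-1 * y + 1)) 0 (3 * h / 2)
  = - RInt (fun y => f (1 - y)) 0 (3 * h / 2)).
{ transitivity (RInt (fun y => opp (f (1 - y))) 0 (3 * h / 2)).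
  - apply RInt_ext. intros x _. replace (-1 * x + 1) with (1 - x) by ring.
    unfold opp; simpl. ring.
  - apply (RInt_opp (V := R_CompleteNormedModule)). apply ex_RInt_cont.
    apply continuous_of_derive with (1 := proj1 (C4_reflect _ _ _ _ _ HF)). }
assert (E2 : - RInt f 1 (1 - 3 * h / 2) = RInt f (1 - 3 * h / 2) 1)
  by (apply (opp_RInt_swap (V := R_CompleteNormedModule)), ex_RInt_cont, Hc).
lra.
Qed.

Lemma sum_n_m_2 (a : nat -> R) (j : nat) :
  sum_n_m a 2 (S (S j)) = sum_f_R0 (fun i => a (S (S i))) j.
Proof.
rewrite <- !sum_n_m_S. symmetry. induction j as [|j IH].
- rewrite sum_n_n. reflexivity.
- rewrite tech5, IH, sum_n_Sm by lia. reflexivity.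
Qed.

Lemma Qform_eq (j : nat) (f : R -> R) (h : R) : h = / INR (j + 3) ->
  Qform (j + 3) f =
    h * (13 / 72 * f 0 + 1 / 2 * f (h / 2) + 4 / 9 * f (3 * h / 4) - 1 / 8 * f h)
    + h * (13 / 72 * f 1 + 1 / 2 * f (1 - h / 2) + 4 / 9 * f (1 - 3 * h / 4) - 1 / 8 * f (1 - h))
    + h * sum_f_R0 (fun i => f (3 * h / 2 + INR i * h)) j.
Proof.
intros ->. unfold Qform, Defs.sigma.
assert (Hn : 0 < INR (j + 3)) by (apply lt_0_INR; lia).
replace (j + 3 - 1)%nat with (S (S j)) by lia. rewrite sum_n_m_2.
rewrite (sum_eq (fun i => f ((2 * INR (S (S i)) - 1) / (2 * INR (j + 3))))
  (fun i => f (3 * / INR (j + 3) / 2 + INR i * / INR (j + 3)))).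
2:{ intros i _. f_equal. rewrite !S_INR. field; lra. }
replace (1 / (2 * INR (j + 3))) with (/ INR (j + 3) / 2) by (field; lra).
replace (3 / (4 * INR (j + 3))) with (3 * / INR (j + 3) / 4) by (field; lra).
replace (1 / INR (j + 3)) with (/ INR (j + 3)) by (field; lra).
rewrite Rminus_0_r. field. lra.
Qed.

(** At [3h/2] and [1 - 3h/2], where the three parts of the interval meet, the derivative terms
    cancel and half weights add up to full ones. For [n = 3] these points coincide and the middle
    part is degenerate. *)
Lemma Qform_remainder_nonpos (n : nat) (f f1 f2 f3 g : R -> R) : (3 <= n)%nat ->
  C4 f f1 f2 f3 g -> (forall x, 0 <= x <= 1 -> 0 <= g x) -> remainder (Qform n) f <= 0.
Proof.
intros Hn HF Hg. pose proof (continuous_of_derive _ _ (proj1 HF)) as Hc.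
replace n with (n - 3 + 3)%nat by lia. set (j := (n - 3)%nat).
set (h := / INR (j + 3)).
assert (Hn0 : 0 < INR (j + 3)) by (apply lt_0_INR; lia).
assert (Hh : 0 < h) by (apply Rinv_0_lt_compat; lra).
assert (Ej : 3 * h / 2 + INR j * h = 1 - 3 * h / 2).
{ assert (E : h * INR (j + 3) = 1) by (unfold h; field; lra).
  rewrite plus_INR in E. simpl in E. lra. }
assert (Hj : 0 <= INR j * h) by (apply Rmult_le_pos; [apply pos_INR|lra]).
unfold remainder. rewrite (Qform_eq j f h eq_refl).
pose proof (left_end f f1 f2 f3 g h HF Hh ltac:(intros; apply Hg; lra)).
pose proof (right_end f f1 f2 f3 g h HF Hh ltac:(intros; apply Hg; lra)).
pose proof (middle_panels f f1 f2 f3 g (3 * h / 2) h j HF Hh ltac:(intros; apply Hg; lra)) as HM.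
rewrite Ej in HM.
rewrite (RInt_split f 0 (3 * h / 2)), (RInt_split f (3 * h / 2) (1 - 3 * h / 2)) by exact Hc.
lra.
Qed.

(** * The formula Q_{n+6} *)

(* The nodes of [Qform n] in units of 1 / (4 n). *)
Definition position (n i : nat) : nat :=
  if le_lt_dec i 1 then 0%nat
  else if le_lt_dec i 4 then i
  else if le_lt_dec i (n + 2) then (4 * i - 14)%nat
  else if le_lt_dec i (n + 5) then (3 * n + i - 7)%nat
  else (4 * n)%nat.

Definition weight (n i : nat) : R :=
  (if le_lt_dec i 1 then 13 / 72
   else if le_lt_dec i 2 then 1 / 2
   else if le_lt_dec i 3 then 4 / 9
   else if le_lt_dec i 4 then - (1 / 8)
   else if le_lt_dec i (n + 2) then 1
   else if le_lt_dec i (n + 3) then - (1 / 8)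
   else if le_lt_dec i (n + 4) then 4 / 9
   else if le_lt_dec i (n + 5) then 1 / 2
   else 13 / 72) / INR n.

Lemma Qform_quadrature (n : nat) : (3 <= n)%nat -> is_quadrature (n + 6) (Qform n).
Proof.
intros Hn. assert (Hn0 : 0 < INR n) by (apply lt_0_INR; lia).
exists (fun i => INR (position n i) / (4 * INR n)), (weight n). split; [|split].
- intros i Hi.
  assert (Hp : (position n i <= 4 * n)%nat) by (unfold position; repeat destruct le_lt_dec; lia).
  apply le_INR in Hp. rewrite mult_INR in Hp. simpl (INR 4) in Hp.
  split; [apply Rdiv_le_0_compat; [apply pos_INR|lra]|].
  apply Rmult_le_reg_r with (4 * INR n); [lra|].
  replace (INR (position n i) / (4 * INR n) * (4 * INR n)) with (INR (position n i)) by (field; lra).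
  lra.
- intros i k Hi Hik Hk. apply Rmult_lt_compat_r; [apply Rinv_0_lt_compat; lra|].
  apply lt_INR. unfold position; repeat destruct le_lt_dec; lia.
- intros f. destruct n as [|[|[|j]]]; try lia. clear Hn.
  replace (S (S (S j))) with (j + 3)%nat in * by lia.
  rewrite (Qform_eq j f _ eq_refl).
  set (F := fun i => weight (j + 3) i * f (INR (position (j + 3) i) / (4 * INR (j + 3)))).
  replace (j + 3 + 6)%nat with (S (S (S (S (S (S (S (S (S j))))))))) by lia.
  (* Four terms are split off at each end; the interior ones, of equal weight, stay a sum. *)
  rewrite (sum_Sn_m F 1), (sum_Sn_m F 2), (sum_Sn_m F 3), (sum_Sn_m F 4) by lia.
  rewrite 4!(sum_n_Sm F 5) by lia.
  change (sum_n_m F 5 (S (S (S (S (S j)))))) with (sum_n_m F (S (S (S 2))) (S (S (S (S (S j)))))).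
  rewrite <- 3!sum_n_m_S, sum_n_m_2. unfold plus; simpl.
  set (h := / INR (j + 3)).
  assert (Hj : INR (j + 3) = INR j + 3) by (rewrite plus_INR; simpl; ring).
  assert (Hj0 : 0 < INR j + 3) by (rewrite <- Hj; exact Hn0).
  assert (V : forall i w p, weight (j + 3) i = w / INR (j + 3) ->
    INR (position (j + 3) i) = 4 * INR (j + 3) * p -> F i = h * (w * f p)).
  { intros i w p Ew Ep. unfold F. rewrite Ew, Ep. unfold h.
    replace (4 * INR (j + 3) * p / (4 * INR (j + 3))) with p by (field; lra). field. lra. }
  rewrite (V 1%nat (13 / 72) 0), (V 2%nat (1 / 2) (h / 2)), (V 3%nat (4 / 9) (3 * h / 4)),
    (V 4%nat (- (1 / 8)) h), (V (S (S (S (S (S (S j)))))) (- (1 / 8)) (1 - h)),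
    (V (S (S (S (S (S (S (S j))))))) (4 / 9) (1 - 3 * h / 4)),
    (V (S (S (S (S (S (S (S (S j)))))))) (1 / 2) (1 - h / 2)),
    (V (S (S (S (S (S (S (S (S (S j))))))))) (13 / 72) 1).
  2-17: unfold h, weight, position; repeat destruct le_lt_dec; try lia; try reflexivity;
    rewrite ?minus_INR, ?plus_INR, ?mult_INR, ?S_INR, ?Hj by lia; change (INR 0) with 0; field; lra.
  rewrite (sum_eq (fun i => F (S (S (S (S (S i)))))) (fun i => f (3 * h / 2 + INR i * h) * h)).
  { rewrite <- scal_sum. ring. }
  intros i Hi. rewrite (V _ 1 (3 * h / 2 + INR i * h)); [ring| |];
    unfold h, weight, position; repeat destruct le_lt_dec; try lia; try reflexivity.
  rewrite minus_INR, mult_INR, !S_INR, Hj by lia. change (INR 0) with 0. field. lra.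
Qed.

(** * The exact error constant and the limit of the ratio *)

Lemma C4_monomial : C4 (fun x => 0 + 0 * x + 0 * x ^ 2 / 2 + 0 * x ^ 3 / 6 + 1 * x ^ 4 / 24)
  (fun x => 0 + 0 * x + 0 * x ^ 2 / 2 + 1 * x ^ 3 / 6) (fun x => 0 + 0 * x + 1 * x ^ 2 / 2)
  (fun x => 0 + 1 * x) (fun _ => 1).
Proof. apply C4_quartic. Qed.

(** [x^4 / 24], left unreduced so that it agrees with [C4_monomial] by conversion. *)
Definition monomial (x : R) : R := 0 + 0 * x + 0 * x ^ 2 / 2 + 0 * x ^ 3 / 6 + 1 * x ^ 4 / 24.

(** The fourth derivative is 1 everywhere, so the intermediate point drops out; uniqueness of the
    constant follows. *)
Lemma has_error_constant_monomial (Q : (R -> R) -> R) (c : R) :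
  has_error_constant 4 Q c -> c = remainder Q monomial.
Proof.
intros Hc. destruct (Hc _ _ (C_on_of_C4 _ _ _ _ _ C4_monomial)) as (xi & _ & E).
rewrite Rmult_1_r in E. symmetry; exact E.
Qed.

Lemma error_constant_eq (Q : (R -> R) -> R) (c : R) :
  has_error_constant 4 Q c -> error_constant 4 Q = c.
Proof.
intros Hc. unfold error_constant.
apply (iota_unique (V := R_CompleteNormedModule)); [|exact Hc].
intros y Hy. rewrite (has_error_constant_monomial Q y Hy).
symmetry; apply has_error_constant_monomial, Hc.
Qed.

Definition Qform_constant (n : nat) : R := - (7 / (5760 * INR n ^ 4)) * (1 - 15 / (14 * INR n)).

(** The classical sum over the first [j + 2] odd numbers, less the term of 1. *)
Lemma sum_odd_fourth_powers (j : nat) :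
  sum_f_R0 (fun i => (2 * INR i + 3) ^ 4) j =
  (INR j + 2) * (48 * (INR j + 2) ^ 4 - 40 * (INR j + 2) ^ 2 + 7) / 15 - 1.
Proof.
induction j as [|j IH]; [simpl; field|]. rewrite tech5, IH, S_INR. field.
Qed.

Lemma Qform_remainder_monomial (n : nat) : (3 <= n)%nat ->
  remainder (Qform n) monomial = Qform_constant n.
Proof.
intros Hn. destruct n as [|[|[|j]]]; try lia. clear Hn.
replace (S (S (S j))) with (j + 3)%nat by lia.
assert (Hj : INR (j + 3) = INR j + 3) by (rewrite plus_INR; simpl; ring).
pose proof (pos_INR j) as Hj0.
unfold remainder, Qform_constant. rewrite (Qform_eq j _ _ eq_refl).
assert (HI : RInt monomial 0 1 = 1 / 120).
{ apply is_RInt_unique. replace (1 / 120) with (minus (1 ^ 5 / 120) (0 ^ 5 / 120))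
   by (unfold minus, plus, opp; simpl; field).
  apply (is_RInt_derive (V := R_CompleteNormedModule) (fun x => x ^ 5 / 120)).
  - intros x _. unfold monomial. auto_derive; auto. field.
  - intros x _. apply continuous_of_derive with (1 := proj1 C4_monomial). }
rewrite HI.
(* The inner nodes are [(2 i + 3) / (2 n)], and [384 = 24 * 2^4]. *)
rewrite (sum_eq _ (fun i => (2 * INR i + 3) ^ 4 * (/ INR (j + 3) ^ 4 / 384))).
- rewrite <- scal_sum, sum_odd_fourth_powers, Hj. unfold monomial. field. lra.
- intros i _. rewrite Hj. unfold monomial. field. lra.
Qed.

Lemma Qform_constant_neg (n : nat) : (3 <= n)%nat -> Qform_constant n < 0.
Proof.
intros Hn. apply le_INR in Hn. simpl (INR 3) in Hn. unfold Qform_constant.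
assert (H4 : 0 < INR n ^ 4) by (apply pow_lt; lra).
assert (0 < 7 / (5760 * INR n ^ 4)) by (apply Rdiv_lt_0_compat; lra).
assert (15 / (14 * INR n) < 1).
{ apply Rmult_lt_reg_r with (14 * INR n); [lra|].
  replace (15 / (14 * INR n) * (14 * INR n)) with 15 by (field; lra). lra. }
nra.
Qed.

Lemma continuous_extrema_01 (g : R -> R) : (forall x, continuous g x) ->
  exists a b, I01 a /\ I01 b /\ forall x, I01 x -> g a <= g x <= g b.
Proof.
intros Hg.
assert (Hc : forall x, 0 <= x <= 1 -> continuity_pt g x)
  by (intros x _; apply continuity_pt_filterlim, Hg).
destruct (continuity_ab_min g 0 1 ltac:(lra) Hc) as (a & Ha & Ia).
destruct (continuity_ab_maj g 0 1 ltac:(lra) Hc) as (b & Hb & Ib).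
exists a, b. repeat split; try apply Ia; try apply Ib; auto.
Qed.

(** Nonpositivity for [f - (min g) x^4 / 24] and [(max g) x^4 / 24 - f] traps [r / c] between the
    extreme values of the fourth derivative; the intermediate value theorem gives the point. *)
Lemma Qform_has_error_constant (n : nat) : (3 <= n)%nat ->
  has_error_constant 4 (Qform n) (Qform_constant n).
Proof.
intros Hn f g Hfg.
destruct (C4_of_C_on f g Hfg) as (f0 & f1 & f2 & f3 & g0 & HF & Ef & Eg).
pose proof (Qform_quadrature n Hn) as HQ.
pose proof (Qform_constant_neg n Hn) as Hneg.
assert (E : remainder (Qform n) f = remainder (Qform n) f0).
{ unfold remainder. f_equal.
  - apply RInt_ext. rewrite Rmin_left, Rmax_right by lra.
    intros x Hx. apply Ef. unfold I01; lra.
  - destruct HQ as (tau & a & Hr & _ & HQ). rewrite !HQ.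
    apply sum_n_m_ext_loc. intros i Hi. rewrite Ef; [reflexivity|apply Hr, Hi]. }
rewrite E.
pose proof HF as (F0 & _ & _ & _ & Hg0).
destruct (continuous_extrema_01 g0 Hg0) as (a & b & Ia & Ib & Hab).
pose proof (continuous_of_derive _ _ F0) as Hc0.
pose proof (continuous_of_derive _ _ (proj1 C4_monomial)) as Hcm.
assert (Hlo : remainder (Qform n) f0 <= g0 a * Qform_constant n).
{ pose proof (Qform_remainder_nonpos n _ _ _ _ _ Hn
    (C4_lin 1 (- g0 a) _ _ _ _ _ _ _ _ _ _ HF C4_monomial)) as H.
  cbv beta in H.
  specialize (H ltac:(intros x Hx; specialize (Hab x Hx); lra)).
  change (remainder (Qform n) (fun x => 1 * f0 x + - g0 a * monomial x) <= 0) in H.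
  rewrite (remainder_lin _ _ _ _ _ _ HQ Hc0 Hcm) in H.
  rewrite Qform_remainder_monomial in H by exact Hn. lra. }
assert (Hhi : g0 b * Qform_constant n <= remainder (Qform n) f0).
{ pose proof (Qform_remainder_nonpos n _ _ _ _ _ Hn
    (C4_lin (-1) (g0 b) _ _ _ _ _ _ _ _ _ _ HF C4_monomial)) as H.
  cbv beta in H.
  specialize (H ltac:(intros x Hx; specialize (Hab x Hx); lra)).
  change (remainder (Qform n) (fun x => -1 * f0 x + g0 b * monomial x) <= 0) in H.
  rewrite (remainder_lin _ _ _ _ _ _ HQ Hc0 Hcm) in H.
  rewrite Qform_remainder_monomial in H by exact Hn. lra. }
set (r := remainder (Qform n) f0) in *. set (c := Qform_constant n) in *.
destruct (IVT_gen g0 a b (r / c)) as (xi & Hxi & Exi).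
- intros x. apply continuity_pt_filterlim, Hg0.
- rewrite Rmin_left, Rmax_right by apply (Hab b Ib).
  split; apply Rmult_le_reg_r with (- c); try lra;
   replace (r / c * - c) with (- r) by (field; lra); lra.
- exists xi.
  assert (Ixi : I01 xi).
  { unfold I01 in *. revert Hxi. unfold Rmin, Rmax; repeat destruct Rle_dec; lra. }
  split; [exact Ixi|]. rewrite Eg, Exi by exact Ixi. field; lra.
Qed.

(** [Qform n] itself competes for the supremum, and [error_constant_le] with [N = n + 6] bounds
    every competitor. *)
Lemma c_minus_bounds (n : nat) : (3 <= n)%nat ->
  Qform_constant n <= c_minus (n + 6) 4 <= - (7 / (5760 * (INR n + 7) ^ 4)).
Proof.
intros Hn. unfold c_minus.
set (E := fun c : R => exists Q, is_quadrature (n + 6) Q /\ negative_definite 4 Q /\ c = error_constant 4 Q).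
destruct (Lub_Rbar_correct E) as [Hub Hlub].
assert (HE : E (Qform_constant n)).
{ exists (Qform n). split; [apply Qform_quadrature, Hn|]. split.
  - exists (Qform_constant n). split; [apply Qform_constant_neg, Hn|apply Qform_has_error_constant, Hn].
  - symmetry; apply error_constant_eq, Qform_has_error_constant, Hn. }
assert (HB : is_ub_Rbar E (- (7 / (5760 * (INR n + 7) ^ 4)))).
{ intros c (Q & HQ & (c' & Hneg & Hc) & ->). rewrite (error_constant_eq Q c' Hc). simpl.
  replace (INR n + 7) with (INR (S (n + 6))) by (rewrite S_INR, plus_INR; simpl; ring).
  apply error_constant_le with Q; auto; lia. }
specialize (Hub _ HE). specialize (Hlub _ HB).
(* The two finite bounds exclude the infinite cases, in which [real] would return 0. *)
destruct (Lub_Rbar E); simpl in *; [lra|contradiction|contradiction].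
Qed.

Lemma ratio_lim : is_lim_seq (fun n => ((INR n + 7) / INR n) ^ 4) 1.
Proof.
assert (H1 : is_lim_seq (fun n => (INR n + 7) / INR n) 1).
{ apply is_lim_seq_ext_loc with (fun n => 1 + 7 * / INR n).
  - exists 1%nat. intros n Hn. apply le_INR in Hn. simpl in Hn. field. lra.
  - replace (Finite 1) with (Finite (1 + 7 * 0)) by (f_equal; ring).
    apply is_lim_seq_plus'; [apply is_lim_seq_const|].
    apply (is_lim_seq_scal_l (fun n => / INR n) 7 0).
    apply (is_lim_seq_inv INR p_infty); [apply is_lim_seq_INR|discriminate]. }
replace (Finite 1) with (Finite (1 * (1 * (1 * 1)))) by (f_equal; ring).
apply is_lim_seq_ext with (fun n => (INR n + 7) / INR n * ((INR n + 7) / INR n *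
  ((INR n + 7) / INR n * ((INR n + 7) / INR n)))); [intros; ring|].
repeat apply is_lim_seq_mult'; exact H1.
Qed.

Theorem mainTheorem6 :
  (forall n : nat, (3 <= n)%nat ->
     is_quadrature (n + 6) (Qform n) /\
     negative_definite 4 (Qform n) /\
     error_constant 4 (Qform n)
       = - (7 / (5760 * INR n ^ 4)) * (1 - 15 / (14 * INR n))) /\
  is_lim_seq (fun n : nat => error_constant 4 (Qform n) / c_minus (n + 6) 4) 1.
Proof.
split.
- intros n Hn. split; [apply Qform_quadrature, Hn|]. split.
  + exists (Qform_constant n).
    split; [apply Qform_constant_neg, Hn|apply Qform_has_error_constant, Hn].
  + apply error_constant_eq, Qform_has_error_constant, Hn.
(* Both constants are negative, so the ratio is at least 1; the upper estimate uses
   [1 - 15 / (14 n) <= 1]. *)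
- apply is_lim_seq_le_le_loc with (fun _ => 1) (fun n => ((INR n + 7) / INR n) ^ 4);
    [|apply is_lim_seq_const|apply ratio_lim].
  exists 3%nat. intros n Hn.
  rewrite (error_constant_eq _ _ (Qform_has_error_constant n Hn)).
  pose proof (c_minus_bounds n Hn) as Hb. pose proof (Qform_constant_neg n Hn) as Hneg.
  set (d := c_minus (n + 6) 4) in *. set (c := Qform_constant n) in *.
  apply le_INR in Hn. simpl (INR 3) in Hn.
  assert (H4 : 0 < INR n ^ 4) by (apply pow_lt; lra).
  assert (H7 : 0 < (INR n + 7) ^ 4) by (apply pow_lt; lra).
  assert (Hp : 0 < 7 / (5760 * (INR n + 7) ^ 4)) by (apply Rdiv_lt_0_compat; lra).
  split; apply Rmult_le_reg_r with (- d); try lra;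
   replace (c / d * - d) with (- c) by (field; lra); [lra|].
  apply Rle_trans with (7 / (5760 * INR n ^ 4)).
  + unfold c, Qform_constant.
    assert (0 < 7 / (5760 * INR n ^ 4)) by (apply Rdiv_lt_0_compat; lra).
    assert (0 < 15 / (14 * INR n)) by (apply Rdiv_lt_0_compat; lra). nra.
  + replace (7 / (5760 * INR n ^ 4)) with
     (((INR n + 7) / INR n) ^ 4 * (7 / (5760 * (INR n + 7) ^ 4))) by (field; lra).
    apply Rmult_le_compat_l; [|lra].
    apply pow_le, Rdiv_le_0_compat; lra.
Qed.
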